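(* Consider an execution of the DRL transition system and let $Q$ be a finalized set of snapshots, all taken at times before $t_f$. For a time $t$, let $Q_t$ be the restriction of $Q$ to those actors whose snapshot in $Q$ was taken before time $t$. Then for all times $t$: (1) if $B\in\mathrm{dom}(Q_t)$ and a refob $x: A\to B$ is unreleased at time $t$, then $Q\vdash\mathrm{Chain}(x)$; and (2) all actors of $\mathrm{dom}(Q_t)$ are blocked at time $t$. (In particular $Q_t=Q$ for $t\ge t_f$.)
   Context: DRL transition system. Refobs are triples $x: A\to B$ (token $x$, owner $A$, target $B$). Facts: $\mathrm{Created}(x)$, $\mathrm{Released}(x)$, $\mathrm{CreatedUsing}(x,y)$, $\mathrm{Activated}(x)$, $\mathrm{Unreleased}(x)$, $\mathrm{SentCount}(x,n)$, $\mathrm{RecvCount}(x,n)$. A knowledge set $\Phi$ is a finite set of facts; $\Phi\vdash\varphi$ means derivability in first-order logic plus: if no $\mathrm{SentCount}(x,n)\in\Phi$ then $\Phi\vdash\mathrm{SentCount}(x,0)$; likewise for $\mathrm{RecvCount}$; $\Phi\vdash\mathrm{Created}(x)\wedge\neg\mathrm{Released}(x)$ gives $\Phi\vdash\mathrm{Unreleased}(x)$; $\Phi\vdash\mathrm{CreatedUsing}(x,y)$ gives $\Phi\vdash\mathrm{Created}(y)$. $\mathrm{IncSent}/\mathrm{IncRecv}(x,\Phi)$ increment (or create with value $1$) the corresponding count. Messages: $\mathrm{App}(x,R)$, $\mathrm{Info}(y,z,B)$, $\mathrm{Release}(x,n)$. A configuration $(\alpha,\mu,\rho,\chi)$: $\alpha$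 maps internal actors to busy $[\Phi]$ or idle $(\Phi)$ states; $\mu$ gives undelivered messages of each actor; receptionists $\rho\subseteq\mathrm{dom}(\alpha)$; external actors $\chi$. Initial configuration: one busy actor $A$ with $\{\mathrm{Activated}(x:A\to E),\mathrm{Created}(y:A\to A),\mathrm{Activated}(y:A\to A)\}$, no messages, $\rho=\emptyset$, $\chi=\{E\}$. Events: Spawn$(x,A,B)$: busy $A$, fresh $x,y,B$; $A$ adds $\mathrm{Activated}(x:A\to B)$; new busy $B$ with $\{\mathrm{Created}(x:A\to B),\mathrm{Created}(y:B\to B),\mathrm{Activated}(y:B\to B)\}$. Send$(x,\vec y,\vec z,A,B,\vec C)$: busy $A$ with $\Phi\vdash\mathrm{Activated}(x:A\to B)$ and $\Phi\vdash\mathrm{Activated}(y_i:A\to C_i)$, fresh $z_i$; $A$'s set becomes $\mathrm{IncSent}(x,\Phi)\cup\{\mathrm{CreatedUsing}(y_i,z_i)\}$; $\mathrm{App}(x,\{z_i:B\to C_i\})$ sent to $B$. Receive$(x,B,R)$: idle $B$ consumes $\mathrm{App}(x,R)$, becomes busy with $\mathrm{IncRecv}(x,\Phi)\cup\{\mathrm{Activated}(z):z\in R\}$. Idle$(A)$: busy $A$ becomes idle. SendInfo$(y,z,A,B,C)$: busy $A$ containing $\mathrm{CreatedUsing}(y:A\to C,z:B\to C)$ removes it, increments send count of $y$, sends $\mathrm{Info}(y,z,B)$ to $C$. Info$(y,z,B,C)$: idle $C$ consumes it, stays idle with $\mathrm{IncRecv}(y,\Phi)\cup\{\mathrm{Created}(z:B\to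 C)\}$. SendRelease$(x,A,B)$: busy $A$ with set $\Phi\cup\{\mathrm{Activated}(x:A\to B),\mathrm{SentCount}(x,n)\}$, no $\mathrm{CreatedUsing}(x,y)\in\Phi$: set becomes $\Phi$; sends $\mathrm{Release}(x,n)$ to $B$. Release$(x,A,B)$: idle $B$ consumes $\mathrm{Release}(x,n)$ only if $\Phi\vdash\mathrm{RecvCount}(x,n)$; adds $\mathrm{Released}(x)$; $x$ is released. Compaction$(x,B,C)$: idle $C$ containing $\mathrm{Created}(x:B\to C),\mathrm{Released}(x)$ removes them and any $\mathrm{RecvCount}(x,n)$. Snapshot$(A,\Phi)$: idle $A$; no change; records $\Phi$ as $A$'s snapshot. In$(x,A,R)$: $A\in\rho$ receives from outside $\mathrm{App}(x,R)$ with fresh refobs owned by $A$ whose internal targets lie in $\rho$; external targets join $\chi$. Out$(x,B,R)$: $B\in\chi$ consumes $\mathrm{App}(x,R)$; internal targets of $R$ join $\rho$. ReleaseOut/InfoOut: Release/Info messages to external actors are dropped. Times index the configurations $\kappa_t$ of an execution. A refob is unreleased once created until its target performs Release for it. An actor is blocked if it is idle, not a receptionist, and has no undelivered messages. A set of snapshots $Q$ maps (internal) actors to knowledge sets recorded by their Snapshot events in the execution (at most one per actor). For a refob $x:A\to B$: $Q\vdash\mathrm{Activated}(x)$, $Q\vdash\mathrm{SentCount}(x,n)$, $Q\vdash\mathrm{CreatedUsing}(x,y)$ mean $A\in\mathrm{dom}(Q)$ and $Q(A)$ derives the fact; $Q\vdash\mathrm{Created}(x)$, $Q\vdash\mathrm{Released}(x)$,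 $Q\vdash\mathrm{RecvCount}(x,n)$ mean $B\in\mathrm{dom}(Q)$ and $Q(B)$ derives the fact. $Q\vdash\mathrm{Chain}(x:A\to B)$ iff there are refobs $x_1:A_1\to B,\dots,x_n:A_n\to B$ with $Q\vdash\mathrm{Created}(x_1)$, $Q\not\vdash\mathrm{Released}(x_1)$, for all $i<n$ $Q\vdash\mathrm{CreatedUsing}(x_i,x_{i+1})$ and $Q\not\vdash\mathrm{Released}(x_{i+1})$, and $A_n=A$, $x_n=x$. $Q\vdash\mathrm{Relevant}(x)$ iff for some $n$, $Q\vdash\mathrm{Activated}(x)$, $Q\vdash\mathrm{SentCount}(x,n)$, $Q\vdash\mathrm{RecvCount}(x,n)$. $Q$ is finalized if for all $B\in\mathrm{dom}(Q)$ and all $x:A\to B$, $Q\vdash\mathrm{Chain}(x)$ implies $A\in\mathrm{dom}(Q)$ and $Q\vdash\mathrm{Relevant}(x)$. *)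

(* Defs.v *)
From HB Require Import structures.
From mathcomp Require Import all_boot finmap multiset.

Set Implicit Arguments.
Unset Strict Implicit.
Unset Printing Implicit Defensive.

Local Open Scope fset_scope.
Local Open Scope fmap_scope.
Local Open Scope nat_scope.

Section DRL.
Context {Token Actor : choiceType}.

(* [(x, A, B)] is the refob  x : A -> B. *)
Definition refob : Type := (Token * Actor * Actor)%type.

Definition token (x : refob) : Token := x.1.1.
Definition owner (x : refob) : Actor := x.1.2.
Definition target (x : refob) : Actor := x.2.

Inductive fact : Type :=
| Created of refob
| Released of refob
| CreatedUsing of refob & refob
| Activated of refob
| Unreleased of refob
| SentCount of refob & nat
| RecvCount of refob & nat.

Definition fact_code (f : fact) : nat * (refob + refob * refob + refob * nat) :=
  match f with
  | Created x => (0, inl (inl x))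
  | Released x => (1, inl (inl x))
  | CreatedUsing x y => (2, inl (inr (x, y)))
  | Activated x => (3, inl (inl x))
  | Unreleased x => (4, inl (inl x))
  | SentCount x n => (5, inr (x, n))
  | RecvCount x n => (6, inr (x, n))
  end.

Definition fact_decode (c : nat * (refob + refob * refob + refob * nat)) :
    option fact :=
  match c with
  | (0, inl (inl x)) => Some (Created x)
  | (1, inl (inl x)) => Some (Released x)
  | (2, inl (inr (x, y))) => Some (CreatedUsing x y)
  | (3, inl (inl x)) => Some (Activated x)
  | (4, inl (inl x)) => Some (Unreleased x)
  | (5, inr (x, n)) => Some (SentCount x n)
  | (6, inr (x, n)) => Some (RecvCount x n)
  | _ => None
  end.

Lemma fact_codeK : pcancel fact_code fact_decode.
Proof. by case. Qed.

HB.instance Definition _ := Choice.copy fact (pcan_type fact_codeK).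

Definition knowledge : Type := {fset fact}.

(* A knowledge set only contains ground atoms, so first-order derivability of
   an atom is membership closed under the four additional rules. [Released x]
   is derivable only by membership: the premise [Released x \notin Phi] of
   [derives_unreleased] is the (closed-world) reading of "not Released(x)". *)
Inductive derives (Phi : knowledge) : fact -> Prop :=
| derives_mem f : f \in Phi -> derives Phi f
| derives_sent0 x :
    (forall n, SentCount x n \notin Phi) -> derives Phi (SentCount x 0)
| derives_recv0 x :
    (forall n, RecvCount x n \notin Phi) -> derives Phi (RecvCount x 0)
| derives_unreleased x :
    derives Phi (Created x) -> Released x \notin Phi ->
    derives Phi (Unreleased x)
| derives_created x y :
    derives Phi (CreatedUsing x y) -> derives Phi (Created y).

Definition is_sent_count (x : refob) (f : fact) : bool :=
  if f is SentCount y _ then y == x else false.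

Definition is_recv_count (x : refob) (f : fact) : bool :=
  if f is RecvCount y _ then y == x else false.

Definition inc_count (f : fact) : fact :=
  match f with
  | SentCount y n => SentCount y n.+1
  | RecvCount y n => RecvCount y n.+1
  | _ => f
  end.

Definition IncSent (x : refob) (Phi : knowledge) : knowledge :=
  if has (is_sent_count x) Phi
  then [fset (if is_sent_count x f then inc_count f else f) | f in Phi]
  else SentCount x 1 |` Phi.

Definition IncRecv (x : refob) (Phi : knowledge) : knowledge :=
  if has (is_recv_count x) Phi
  then [fset (if is_recv_count x f then inc_count f else f) | f in Phi]
  else RecvCount x 1 |` Phi.

Inductive msg : Type :=
| App of refob & {fset refob}
| Info of refob & refob & Actor
| Release of refob & nat.

Definition msg_code (m : msg) :
    refob * {fset refob} + refob * refob * Actor + refob * nat :=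
  match m with
  | App x R => inl (inl (x, R))
  | Info y z B => inl (inr (y, z, B))
  | Release x n => inr (x, n)
  end.

Definition msg_decode
    (c : refob * {fset refob} + refob * refob * Actor + refob * nat) : msg :=
  match c with
  | inl (inl (x, R)) => App x R
  | inl (inr (y, z, B)) => Info y z B
  | inr (x, n) => Release x n
  end.

Lemma msg_codeK : cancel msg_code msg_decode.
Proof. by case. Qed.

HB.instance Definition _ := Choice.copy msg (can_type msg_codeK).

Inductive actor_state : Type :=
| Busy of knowledge
| Idle of knowledge.

Definition facts_of (s : actor_state) : knowledge :=
  match s with Busy Phi => Phi | Idle Phi => Phi end.

Definition internals : Type := {fmap Actor -> actor_state}.

(* Delivery is unordered, but multiplicities matter: each actor has a finite
   multiset of undelivered messages. *)
Definition mailboxes : Type := {fsfun Actor -> {mset msg}%mset with mset0}.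

Definition inbox (mu : mailboxes) (A : Actor) : {mset msg}%mset := mu A.

Record config : Type := Config {
  actors : internals;
  undelivered : mailboxes;
  receptionists : {fset Actor};
  externals : {fset Actor}
}.

Definition post (mu : mailboxes) (B : Actor) (m : msg) : mailboxes :=
  [fsfun mu with B |-> (m +` inbox mu B)%mset].

Definition consume (mu : mailboxes) (B : Actor) (m : msg) : mailboxes :=
  [fsfun mu with B |-> (inbox mu B `\ m)%mset].

Definition fact_refobs (f : fact) : seq refob :=
  match f with
  | Created x | Released x | Activated x | Unreleased x
  | SentCount x _ | RecvCount x _ => [:: x]
  | CreatedUsing x y => [:: x; y]
  end.

Definition msg_refobs (m : msg) : seq refob :=
  match m with
  | App x R => x :: enum_fset R
  | Info y z _ => [:: y; z]
  | Release x _ => [:: x]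
  end.

Definition mentions (c : config) (x : refob) : Prop :=
  (exists A s f, [/\ (actors c).[? A] = Some s, f \in facts_of s
                   & x \in fact_refobs f]) \/
  (exists A m, m \in inbox (undelivered c) A /\ x \in msg_refobs m).

Definition initial (c : config) : Prop :=
  exists (x y : Token) (A E : Actor),
    [/\ x != y, A != E
      & c = Config [fmap].[A <- Busy [fset Activated (x, A, E);
                                           Created (y, A, A);
                                           Activated (y, A, A)]]
                   [fsfun] fset0 [fset E]].

(* An argument x, y, z of an event is a token when the owner and the target of
   the corresponding refob are among the other arguments, and a refob
   otherwise. The vectors (y_i), (z_i), (C_i) of a Send event are given as the
   list of the triples (y_i, z_i, C_i); a Spawn event also records the token y
   of the self-refob of the new actor. *)
Inductive event : Type :=
| ESpawn (x y : Token) (A B : Actor)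
| ESend (x : Token) (yzC : seq (Token * Token * Actor)) (A B : Actor)
| EReceive (x : refob) (B : Actor) (R : {fset refob})
| EIdle (A : Actor)
| ESendInfo (y z : Token) (A B C : Actor)
| EInfo (y : refob) (z : Token) (B C : Actor)
| ESendRelease (x : Token) (A B : Actor)
| ERelease (x : Token) (A B : Actor)
| ECompaction (x : Token) (B C : Actor)
| ESnapshot (A : Actor) (Phi : knowledge)
| EIn (x : refob) (A : Actor) (R : {fset refob})
| EOut (x : refob) (B : Actor) (R : {fset refob})
| EReleaseOut (x : refob) (B : Actor)
| EInfoOut (y z : refob) (B C : Actor).

Implicit Types (al : internals) (mu : mailboxes) (rho chi : {fset Actor}).
Implicit Types (A B C : Actor) (Phi : knowledge) (R : {fset refob}).
Implicit Types (x y z : Token) (yzC : seq (Token * Token * Actor)).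

(* Tokens can disappear from a configuration (SendRelease, Compaction), so
   freshness refers to the past of the execution; it is the parameter [fresh].
   Internal and external actors never disappear. *)
Inductive step (fresh : Token -> Prop) : config -> event -> config -> Prop :=
| step_spawn al mu rho chi x y A B Phi :
    al.[? A] = Some (Busy Phi) ->
    fresh x -> fresh y -> x != y -> B \notin domf al -> B \notin chi ->
    step fresh (Config al mu rho chi) (ESpawn x y A B)
      (Config
         al.[A <- Busy (Activated (x, A, B) |` Phi)]
           .[B <- Busy [fset Created (x, A, B); Created (y, B, B);
                             Activated (y, B, B)]]
         mu rho chi)
| step_send al mu rho chi x yzC A B Phi :
    al.[? A] = Some (Busy Phi) ->
    derives Phi (Activated (x, A, B)) ->
    (forall y z C, (y, z, C) \in yzC -> derives Phi (Activated (y, A, C))) ->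
    (forall y z C, (y, z, C) \in yzC -> fresh z) ->
    uniq [seq p.1.2 | p <- yzC] ->
    step fresh (Config al mu rho chi) (ESend x yzC A B)
      (Config
         al.[A <- Busy (IncSent (x, A, B) Phi `|`
                        [fset CreatedUsing (p.1.1, A, p.2) (p.1.2, B, p.2)
                           | p in yzC])]
         (post mu B (App (x, A, B) [fset (p.1.2, B, p.2) | p in yzC]))
         rho chi)
| step_receive al mu rho chi (x : refob) B R Phi :
    al.[? B] = Some (Idle Phi) -> App x R \in inbox mu B ->
    step fresh (Config al mu rho chi) (EReceive x B R)
      (Config al.[B <- Busy (IncRecv x Phi `|` [fset Activated z | z in R])]
         (consume mu B (App x R)) rho chi)
| step_idle al mu rho chi A Phi :
    al.[? A] = Some (Busy Phi) ->
    step fresh (Config al mu rho chi) (EIdle A)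
      (Config al.[A <- Idle Phi] mu rho chi)
| step_send_info al mu rho chi y z A B C Phi :
    al.[? A] = Some (Busy Phi) ->
    CreatedUsing (y, A, C) (z, B, C) \in Phi ->
    step fresh (Config al mu rho chi) (ESendInfo y z A B C)
      (Config
         al.[A <- Busy (IncSent (y, A, C)
                          (Phi `\ CreatedUsing (y, A, C) (z, B, C)))]
         (post mu C (Info (y, A, C) (z, B, C) B)) rho chi)
| step_info al mu rho chi (y : refob) z B C Phi :
    al.[? C] = Some (Idle Phi) -> Info y (z, B, C) B \in inbox mu C ->
    step fresh (Config al mu rho chi) (EInfo y z B C)
      (Config al.[C <- Idle (Created (z, B, C) |` IncRecv y Phi)]
         (consume mu C (Info y (z, B, C) B)) rho chi)
| step_send_release al mu rho chi x n A B Phi :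
    al.[? A] = Some (Busy Phi) ->
    Activated (x, A, B) \in Phi -> SentCount (x, A, B) n \in Phi ->
    (forall y : refob, CreatedUsing (x, A, B) y \notin Phi) ->
    step fresh (Config al mu rho chi) (ESendRelease x A B)
      (Config
         al.[A <- Busy (Phi `\ Activated (x, A, B) `\ SentCount (x, A, B) n)]
         (post mu B (Release (x, A, B) n)) rho chi)
| step_release al mu rho chi x n A B Phi :
    al.[? B] = Some (Idle Phi) -> Release (x, A, B) n \in inbox mu B ->
    derives Phi (RecvCount (x, A, B) n) ->
    step fresh (Config al mu rho chi) (ERelease x A B)
      (Config al.[B <- Idle (Released (x, A, B) |` Phi)]
         (consume mu B (Release (x, A, B) n)) rho chi)
| step_compaction al mu rho chi x B C Phi :
    al.[? C] = Some (Idle Phi) ->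
    Created (x, B, C) \in Phi -> Released (x, B, C) \in Phi ->
    step fresh (Config al mu rho chi) (ECompaction x B C)
      (Config
         al.[C <- Idle [fset f in Phi `\ Created (x, B, C)
                                      `\ Released (x, B, C)
                          | ~~ is_recv_count (x, B, C) f]]
         mu rho chi)
| step_snapshot al mu rho chi A Phi :
    al.[? A] = Some (Idle Phi) ->
    step fresh (Config al mu rho chi) (ESnapshot A Phi)
      (Config al mu rho chi)
(* The refob x of a message received from the outside belongs to an external
   actor. *)
| step_in al mu rho chi (x : refob) A R :
    A \in rho -> owner x \in chi -> target x = A ->
    (forall z : refob, z \in R -> fresh (token z) /\ owner z = A) ->
    {in R &, injective token} ->
    (forall z : refob, z \in R -> target z \in domf al -> target z \in rho) ->
    step fresh (Config al mu rho chi) (EIn x A R)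
      (Config al (post mu A (App x R)) rho
         (chi `|` ([fset target z | z in R] `\` domf al)))
| step_out al mu rho chi (x : refob) B R :
    B \in chi -> App x R \in inbox mu B ->
    step fresh (Config al mu rho chi) (EOut x B R)
      (Config al (consume mu B (App x R))
         (rho `|` ([fset target z | z in R] `&` domf al)) chi)
| step_release_out al mu rho chi (x : refob) n B :
    B \in chi -> Release x n \in inbox mu B ->
    step fresh (Config al mu rho chi) (EReleaseOut x B)
      (Config al (consume mu B (Release x n)) rho chi)
| step_info_out al mu rho chi (y z : refob) B C :
    C \in chi -> Info y z B \in inbox mu C ->
    step fresh (Config al mu rho chi) (EInfoOut y z B C)
      (Config al (consume mu C (Info y z B)) rho chi).

(* [len = Some n] is an execution with n events, [len = None] an infinite one;
   event [evt s] leads from [conf s] to [conf s.+1]. The values of [evt] and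
   [conf] outside of the execution are irrelevant. *)
Definition is_event_index (len : option nat) (s : nat) : bool :=
  if len is Some n then s < n else true.

Definition is_time (len : option nat) (t : nat) : bool :=
  if len is Some n then t <= n else true.

Definition fresh_at (conf : nat -> config) (t : nat) (k : Token) : Prop :=
  forall s (x : refob), s <= t -> mentions (conf s) x -> token x <> k.

Definition execution (len : option nat) (conf : nat -> config)
    (evt : nat -> event) : Prop :=
  initial (conf 0) /\
  (forall s, is_event_index len s ->
     step (fresh_at conf s) (conf s) (evt s) (conf s.+1)).

Definition created_by (e : event) : {fset refob} :=
  match e with
  | ESpawn x y A B => [fset (x, A, B); (y, B, B)]
  | ESend x yzC A B => [fset (p.1.2, B, p.2) | p in yzC]
  | EIn x A R => R
  | _ => fset0
  end.

Definition created_before (conf : nat -> config) (evt : nat -> event)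
    (t : nat) (x : refob) : Prop :=
  mentions (conf 0) x \/ (exists2 s, s < t & x \in created_by (evt s)).

Definition released_before (evt : nat -> event) (t : nat) (x : refob) : Prop :=
  exists2 s, s < t & evt s = ERelease (token x) (owner x) (target x).

Definition unreleased_at (conf : nat -> config) (evt : nat -> event)
    (t : nat) (x : refob) : Prop :=
  created_before conf evt t x /\ ~ released_before evt t x.

Definition blocked (c : config) (A : Actor) : Prop :=
  [/\ exists Phi, (actors c).[? A] = Some (Idle Phi),
      A \notin receptionists c & inbox (undelivered c) A = mset0].

(* [when A] is the index of the Snapshot event of A that is used in Q. *)
Definition snapshot_set (len : option nat) (evt : nat -> event)
    (Q : {fmap Actor -> knowledge}) (when : Actor -> nat) : Prop :=
  forall A Phi, Q.[? A] = Some Phi ->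
    is_event_index len (when A) /\ evt (when A) = ESnapshot A Phi.

Definition before (Q : {fmap Actor -> knowledge}) (when : Actor -> nat)
    (t : nat) : {fmap Actor -> knowledge} :=
  Q.[& [fset A in domf Q | when A < t]].

Definition holder (f : fact) : Actor :=
  match f with
  | Activated x | SentCount x _ | CreatedUsing x _ => owner x
  | Created x | Released x | RecvCount x _ | Unreleased x => target x
  end.

Definition Qderives (Q : {fmap Actor -> knowledge}) (f : fact) : Prop :=
  exists2 Phi, Q.[? holder f] = Some Phi & derives Phi f.

(* The sequence x_1, ..., x_n is [x1 :: s]. *)
Definition Chain (Q : {fmap Actor -> knowledge}) (x : refob) : Prop :=
  exists (x1 : refob) (s : seq refob),
    [/\ last x1 s = x,
        forall y : refob, y \in x1 :: s -> target y = target x,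
        Qderives Q (Created x1), ~ Qderives Q (Released x1)
      & forall i, i < size s ->
          Qderives Q (CreatedUsing (nth x1 (x1 :: s) i) (nth x1 s i)) /\
          ~ Qderives Q (Released (nth x1 s i))].

Definition Relevant (Q : {fmap Actor -> knowledge}) (x : refob) : Prop :=
  exists n, [/\ Qderives Q (Activated x), Qderives Q (SentCount x n)
              & Qderives Q (RecvCount x n)].

Definition finalized (Q : {fmap Actor -> knowledge}) : Prop :=
  forall B (x : refob), B \in domf Q -> target x = B -> Chain Q x ->
    owner x \in domf Q /\ Relevant Q x.

End DRL.

Arguments refob : clear implicits.
Arguments fact : clear implicits.
Arguments knowledge : clear implicits.
Arguments msg : clear implicits.
Arguments config : clear implicits.
Arguments event : clear implicits.

(* Main.v *)
(* By induction on time, the actors whose snapshot was already taken are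
   blocked, hence frozen: they send nothing and only forget facts by compaction.
   Write w for the snapshot time of B, and let x : A -> B be unreleased. If
   Q |- Chain(x), then finalization makes the number of messages sent along x by
   the snapshot of A equal to the number received along x by time w. Whether A
   takes its snapshot before t (then A is frozen since) or after t (then counts
   only grow), no message along x can be pending at a time t >= w, and A cannot
   have consumed a fact CreatedUsing(x, y) between w and its own snapshot,
   because that sends a message along x.

   Chain(x) itself follows by induction on the creation time of x. If x was
   created before w, then at time w either B knows Created(x), or an earlier
   refob y to B is such that CreatedUsing(y, x) is still held by its owner or is
   travelling to B; the latter is excluded by the previous paragraph, and the
   former is visible in Q. If x was created after w by means of y, the same
   argument applies to CreatedUsing(y, x) right after the creation. A refob
   imported from outside requires B to be a receptionist, and then B has an
   earlier refob with an external owner, which is never released; its chain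
   would put an external actor in dom(Q).

   Once all unreleased refobs to B are in chains, B has no pending messages and
   is not a receptionist, so it stays blocked. *)
Require Import Defs.
From mathcomp Require Import all_boot finmap multiset zify.

Set Implicit Arguments.
Unset Strict Implicit.
Unset Printing Implicit Defensive.

Local Open Scope fset_scope.
Local Open Scope fmap_scope.
Local Open Scope nat_scope.

Section Execution.
Context {Token Actor : choiceType}.

Implicit Types (x y z : refob Token Actor) (A B C : Actor).
Implicit Types (f : fact Token Actor).
Implicit Types (Phi : knowledge Token Actor) (m : msg Token Actor).
Implicit Types (al : @internals Token Actor) (mu : @mailboxes Token Actor).
Implicit Types (c : config Token Actor).
Implicit Types (e : event Token Actor) (p : pred (msg Token Actor)).
Implicit Types (fresh : Token -> Prop).

(** * Observables of knowledge, mailboxes and events *)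

Definition knows al A f : bool :=
  if al.[? A] is Some s then f \in facts_of s else false.

Definition pending p mu B : nat := count p (inbox mu B).

(** Only the messages that raise the receive count of [x] are traffic along it; [Release] is tracked
    apart by [releases]. *)
Definition along x m : bool :=
  match m with App y _ | Info y _ _ => y == x | Release _ _ => false end.

Definition carries x m : bool := if m is App _ R then x \in R else false.

Definition releases x m : bool := if m is Release y _ then y == x else false.

(** [EIn] counts as a send, although no internal actor records it, so that [flow] holds for every
    refob. *)
Definition sends_along x e : bool :=
  match e with
  | ESend k _ A B => (k, A, B) == x
  | ESendInfo k _ A _ C => (k, A, C) == x
  | EIn y _ _ => y == x
  | _ => false
  end.

Definition receives_along x e : bool :=
  match e with EReceive y _ _ | EInfo y _ _ _ => y == x | _ => false end.

Definition deactivates x e : bool :=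
  if e is ESendRelease k A B then (k, A, B) == x else false.

Definition frees x e : bool :=
  if e is ERelease k A B then (k, A, B) == x else false.

Lemma knows_at al A s f : al.[? A] = Some s ->
  knows al A f = (f \in facts_of s).
Proof. by rewrite /knows => ->. Qed.

Lemma knows_set al A s C f :
  knows al.[A <- s] C f = if C == A then f \in facts_of s else knows al C f.
Proof. by rewrite /knows fnd_set; case: eqP. Qed.

Lemma knows_domf al A f : knows al A f -> A \in domf al.
Proof. by rewrite /knows; case: fndP. Qed.

Lemma some_domf al A s : al.[? A] = Some s -> A \in domf al.
Proof. by case: fndP. Qed.

(** * Mailboxes as multisets *)

Lemma inbox_post mu B m C :
  inbox (post mu B m) C = if C == B then (m +` inbox mu B)%mset else inbox mu C.
Proof. by rewrite /inbox fsfun_withE. Qed.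

Lemma inbox_consume mu B m C :
  inbox (consume mu B m) C =
  if C == B then (inbox mu B `\ m)%mset else inbox mu C.
Proof. by rewrite /inbox fsfun_withE. Qed.

Lemma count_mset1D p m (M : {mset msg Token Actor}%mset) :
  count p (m +` M)%mset = p m + count p M.
Proof.
suff /permP -> : perm_eq (m +` M)%mset (m :: M) by [].
apply/allP => a _ /=; apply/eqP.
by rewrite count_mem_mset mset1DE /= count_mem_mset [m == a]eq_sym.
Qed.

Lemma pending_post p mu B m C :
  pending p (post mu B m) C = (C == B) && p m + pending p mu C.
Proof.
by rewrite /pending inbox_post; case: eqP => [->|//]; rewrite count_mset1D.
Qed.

Lemma pending_consume p mu B m C : m \in inbox mu B ->
  pending p mu C = (C == B) && p m + pending p (consume mu B m) C.
Proof.
move=> Bm; rewrite /pending inbox_consume; case: eqP => [->|//].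
by rewrite -{1}(msetB1K Bm) count_mset1D.
Qed.

Lemma pendingP p mu B :
  reflect (exists2 m, m \in inbox mu B & p m) (0 < pending p mu B).
Proof. by rewrite -has_count; apply: (iffP hasP) => -[m]; exists m. Qed.

Lemma mem_consume mu B m m' C :
  m' \in inbox (consume mu B m) C -> m' \in inbox mu C.
Proof.
by rewrite inbox_consume; case: eqP => [->|//]; rewrite in_msetB1 => /andP[].
Qed.

Lemma mem_post mu B m m' C :
  m' \in inbox (post mu B m) C =
  ((C == B) && (m' == m)) || (m' \in inbox mu C).
Proof.
by rewrite inbox_post; case: eqP => [->|//] /=; rewrite in_mset1D.
Qed.

Lemma consume_other mu B m m' C :
  m' \in inbox mu C -> (C == B) && (m' == m) \/ m' \in inbox (consume mu B m) C.
Proof.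
rewrite inbox_consume; case: eqP => [->|] /=; last by right.
by move=> Bm'; case: eqP => [|/eqP n]; [left|right];
  rewrite // in_msetB1 (negPf n).
Qed.

(** * Derivability and stored counts *)

Lemma derives_activated Phi x : derives Phi (Activated x) ->
  Activated x \in Phi.
Proof. by move=> H; inversion H. Qed.

Lemma derives_released Phi x : derives Phi (Released x) -> Released x \in Phi.
Proof. by move=> H; inversion H. Qed.

Lemma derives_sent Phi x n : derives Phi (SentCount x n) ->
  SentCount x n \in Phi \/ (n = 0 /\ forall k, SentCount x k \notin Phi).
Proof. by move=> H; inversion H; subst; [left|right]. Qed.

Lemma derives_recv Phi x n : derives Phi (RecvCount x n) ->
  RecvCount x n \in Phi \/ (n = 0 /\ forall k, RecvCount x k \notin Phi).
Proof. by move=> H; inversion H; subst; [left|right]. Qed.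

Lemma mem_IncSent x Phi f :
  ~~ is_sent_count x f -> (f \in IncSent x Phi) = (f \in Phi).
Proof.
move=> nf; rewrite /IncSent; case: ifP => _; last first.
  by rewrite !inE; case: eqP nf => // -> /=; rewrite eqxx.
apply/imfsetP/idP => /= [[g gP Ef]|fP]; last by exists f; rewrite ?(negPf nf).
move: nf; rewrite Ef; case: ifP => // xg.
by case: g xg gP {Ef} => //= y n ->.
Qed.

Lemma mem_IncRecv x Phi f :
  ~~ is_recv_count x f -> (f \in IncRecv x Phi) = (f \in Phi).
Proof.
move=> nf; rewrite /IncRecv; case: ifP => _; last first.
  by rewrite !inE; case: eqP nf => // -> /=; rewrite eqxx.
apply/imfsetP/idP => /= [[g gP Ef]|fP]; last by exists f; rewrite ?(negPf nf).
move: nf; rewrite Ef; case: ifP => // xg.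
by case: g xg gP {Ef} => //= y n ->.
Qed.

(** The hypothesis says that the count is [k]: a positive count is the unique stored value, and
    count 0 is the absence of any stored value. Both branches of [IncSent] are thus covered by one
    statement. *)
Lemma mem_IncSent_count x Phi k n :
    (forall i, (SentCount x i \in Phi) = (i == k) && (0 < i)) ->
  (SentCount x n \in IncSent x Phi) = (n == k.+1).
Proof.
move=> Phik; rewrite /IncSent; case: ifP => [/hasP[g gP]|/hasPn Phi0].
  case: g gP => //= y i iP /eqP Ey; subst y.
  move: iP; rewrite Phik => /andP[/eqP Ei k0]; subst i.
  apply/imfsetP/eqP => /= [[g gP]|->]; last first.
    by exists (SentCount x k); rewrite /= ?Phik eqxx ?k0.
  case: ifP => [|nxg Eg]; last by rewrite -Eg /= eqxx in nxg.
  case: g gP => //= y i iP /eqP Ey; subst y => -[->].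
  by move: iP; rewrite Phik => /andP[/eqP->].
have k0 : k = 0.
  case: k Phik => // k Phik; have := Phi0 (SentCount x k.+1).
  by rewrite Phik /= !eqxx => /(_ isT).
rewrite !inE Phik k0; have -> : (n == 0) && (0 < n) = false by case: n.
by rewrite orbF; apply/eqP/eqP => [[->]|->].
Qed.

Lemma mem_IncRecv_count x Phi k n :
    (forall i, (RecvCount x i \in Phi) = (i == k) && (0 < i)) ->
  (RecvCount x n \in IncRecv x Phi) = (n == k.+1).
Proof.
move=> Phik; rewrite /IncRecv; case: ifP => [/hasP[g gP]|/hasPn Phi0].
  case: g gP => //= y i iP /eqP Ey; subst y.
  move: iP; rewrite Phik => /andP[/eqP Ei k0]; subst i.
  apply/imfsetP/eqP => /= [[g gP]|->]; last first.
    by exists (RecvCount x k); rewrite /= ?Phik eqxx ?k0.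
  case: ifP => [|nxg Eg]; last by rewrite -Eg /= eqxx in nxg.
  case: g gP => //= y i iP /eqP Ey; subst y => -[->].
  by move: iP; rewrite Phik => /andP[/eqP->].
have k0 : k = 0.
  case: k Phik => // k Phik; have := Phi0 (RecvCount x k.+1).
  by rewrite Phik /= !eqxx => /(_ isT).
rewrite !inE Phik k0; have -> : (n == 0) && (0 < n) = false by case: n.
by rewrite orbF; apply/eqP/eqP => [[->]|->].
Qed.

(** The default rule yields 0 only when nothing is stored, and the hypothesis then forces
    [k = 0]. *)
Lemma derives_sent_count Phi x n k :
    (forall i, (SentCount x i \in Phi) = (i == k) && (0 < i)) ->
  derives Phi (SentCount x n) -> n = k.
Proof.
move=> Phik /derives_sent[|[-> /(_ k)]]; rewrite Phik;
  first by case/andP=> /eqP.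
by rewrite eqxx /= -eqn0Ngt => /eqP.
Qed.

Lemma derives_recv_count Phi x n k :
    (forall i, (RecvCount x i \in Phi) = (i == k) && (0 < i)) ->
  derives Phi (RecvCount x n) -> n = k.
Proof.
move=> Phik /derives_recv[|[-> /(_ k)]]; rewrite Phik;
  first by case/andP=> /eqP.
by rewrite eqxx /= -eqn0Ngt => /eqP.
Qed.

(** * Single steps *)

Lemma eq_factE f f' :
  (f == f') =
  match f, f' with
  | Created x, Created y | Released x, Released y
  | Activated x, Activated y | Unreleased x, Unreleased y => x == y
  | CreatedUsing x y, CreatedUsing x' y' => (x == x') && (y == y')
  | SentCount x n, SentCount y k | RecvCount x n, RecvCount y k =>
      (x == y) && (n == k)
  | _, _ => false
  end.
Proof.
by case: f; case: f'.
Qed.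

Definition memE := (in_fset1U, in_fset1, in_fsetU, in_fsetD1, eq_factE).

Lemma mem_activated (R : {fset refob Token Actor}) f :
  (f \in [fset Activated z | z in R]) =
  if f is Activated x then x \in R else false.
Proof.
apply/imfsetP/idP => /= [[z zR ->]//|]; case: f => // x xR; by exists x.
Qed.

Lemma mem_created_using (yzC : seq (Token * Token * Actor)) A B f :
  f \in [fset CreatedUsing (p.1.1, A, p.2) (p.1.2, B, p.2) | p in yzC] ->
  exists k l C, (k, l, C) \in yzC /\ f = CreatedUsing (k, A, C) (l, B, C).
Proof. by case/imfsetP => -[[k l] C] /= klC ->; exists k, l, C. Qed.

Lemma created_using_only (yzC : seq (Token * Token * Actor)) A B f :
  ~~ (if f is CreatedUsing _ _ then true else false) ->
  (f \in [fset CreatedUsing (p.1.1, A, p.2) (p.1.2, B,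
    p.2) | p in yzC]) = false.
Proof. by move=> nf; apply/imfsetP => -[p _ Ef]; rewrite Ef in nf. Qed.

Lemma mem_compaction x Phi f :
  (f \in [fset g in Phi `\ Created x `\ Released x | ~~ is_recv_count x g]) =
  [&& f \in Phi, f != Created x, f != Released x & ~~ is_recv_count x f].
Proof.
apply/imfsetP/and4P => /= [[g + ->]|[fP nC nR nx]].
  by rewrite inE /= !in_fsetD1 => /andP[/and3P[-> -> ->] ->].
by exists f; rewrite // inE /= !in_fsetD1 nC nR fP nx.
Qed.

(** The right to use [x] is a resource that moves from a carrying message to the owner, and from
    there to deactivation; only creation adds to it. It can get lost, as when an external actor
    consumes the message, hence the inequality. *)
Lemma budget_step fresh c e c' x : step fresh c e c' ->
  pending (carries x) (undelivered c') (owner x)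
    + knows (actors c') (owner x) (Activated x) + deactivates x e
  <= pending (carries x) (undelivered c) (owner x)
    + knows (actors c) (owner x) (Activated x) + (x \in created_by e).
Proof.
case=> {c e c'} /=.
- move=> al mu rho chi k l A B Phi EA _ _ _ nB _.
  rewrite !knows_set /= ?memE /= ?memE.
  case: (eqVneq (owner x) B) => [EB|_].
    (* The new actor activates only its self-refob, which is in [created_by] as well. *)
    by case: (x == (l, B, B)) => /=; lia.
  case: (eqVneq (owner x) A) => [->|_]; last by lia.
  by rewrite (knows_at _ EA) /= [x == _]eq_sym; case: eqP => [|_] /=; lia.
- move=> al mu rho chi k yzC A B Phi EA _ _ _ _.
  rewrite pending_post knows_set /= memE mem_IncSent // created_using_only //
    orbF.
  case: (eqVneq (owner x) A) => [->|_] /=; last by case: (x \in _); lia.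
  by rewrite (knows_at _ EA) /=; case: (x \in _); lia.
- move=> al mu rho chi y B R Phi EB yR.
  rewrite knows_set (pending_consume (carries x) (owner x) yR) /=.
  case: eqP => [->|_] /=; last lia.
  by rewrite memE mem_IncRecv // mem_activated (knows_at _ EB) /=; lia.
- move=> al mu rho chi A Phi EA; rewrite knows_set.
  by case: eqP => [->|_]; rewrite ?(knows_at _ EA) /=; lia.
- move=> al mu rho chi k l A B C Phi EA kP;
  rewrite pending_post knows_set /= andbF.
  case: eqP => [->|_] /=; last lia.
  by rewrite mem_IncSent // memE (knows_at _ EA) /= ?eq_factE /=; lia.
- move=> al mu rho chi y k B C Phi EC yP.
  rewrite knows_set (pending_consume (carries x) (owner x) yP) /= andbF.
  case: eqP => [->|_] /=; last lia.
  by rewrite ?memE mem_IncRecv // (knows_at _ EC) /=; lia.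
- move=> al mu rho chi k n A B Phi EA kP _ _.
  rewrite pending_post knows_set /= andbF /= ?memE /=.
  case: eqP => [E|nA] /=.
    rewrite E (knows_at _ EA) /= [x == _]eq_sym.
    by case: eqP => [Ex|_] /=; [rewrite -Ex kP|]; lia.
  by case: eqP => [E|_]; [rewrite -E in nA|lia].
- move=> al mu rho chi k n A B Phi EB kP _.
  rewrite knows_set (pending_consume (carries x) (owner x) kP) /= andbF.
  by case: eqP => [->|_] /=; rewrite ?memE ?(knows_at _ EB) /=; lia.
- move=> al mu rho chi k B C Phi EC _ _; rewrite knows_set /=.
  case: eqP => [->|_]; last lia.
  by rewrite mem_compaction (knows_at _ EC) ?eq_factE /= andbT; lia.
- by move=> al mu rho chi A Phi _; lia.
- move=> al mu rho chi y A R _ _ _ RA _ _; rewrite pending_post /=.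
  by case: eqP => _ /=; lia.
- by move=> al mu rho chi y B R _ yR; rewrite (pending_consume _ _ yR); lia.
- by move=> al mu rho chi y n B _ yR; rewrite (pending_consume _ _ yR); lia.
- by move=> al mu rho chi y z B C _ yR; rewrite (pending_consume _ _ yR); lia.
Qed.

(** * Evolution of the sets of actors, and origin of messages *)

Lemma domf_step fresh c e c' : step fresh c e c' ->
  {subset domf (actors c) <= domf (actors c')}.
Proof. by case=> * A /= AD; rewrite ?dom_setf ?in_fset1U ?AD ?orbT. Qed.

Lemma externals_step fresh c e c' : step fresh c e c' ->
  {subset externals c <= externals c'}.
Proof. by case=> * A /= AD; rewrite ?in_fsetU ?AD ?orbT. Qed.

Lemma receptionists_step fresh c e c' B : step fresh c e c' ->
  B \in receptionists c' ->
  B \in receptionists c \/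
  exists E y R z, [/\ E \in externals c, App y R \in inbox (undelivered c) E,
    z \in R & target z = B] /\ B \in domf (actors c).
Proof.
case=> {c e c'} /=; try by move=> *; left.
move=> al mu rho chi y E R Echi yR; rewrite in_fsetU => /orP[|]; first by left.
by rewrite in_fsetI => /andP[/imfsetP[z /= zR ->] zD]; right; exists E, y, R, z.
Qed.

Lemma disjoint_step fresh c e c' : step fresh c e c' ->
    (forall A, A \in domf (actors c) -> A \notin externals c) ->
  forall A, A \in domf (actors c') -> A \notin externals c'.
Proof.
have upd al A B s : al.[? A] = Some s -> B \in A |` domf al -> B \in domf al.
  by move=> EA; rewrite in_fset1U => /predU1P[->|//]; apply: some_domf EA.
case=> {c e c'} //=.
- move=> al mu rho chi k l A B Phi EA _ _ _ _ nB dj C.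
  by rewrite in_fset1U => /predU1P[->//|/(upd _ _ _ _ EA)]; apply: dj.
- by move=> al mu rho chi k yzC A B Phi EA ? ? ? ? dj D DD;
  apply/dj/(upd _ _ _ _ EA DD).
- by move=> al mu rho chi y B R Phi EA ? dj C CD; apply/dj/(upd _ _ _ _ EA CD).
- by move=> al mu rho chi A Phi EA dj C CD; apply/dj/(upd _ _ _ _ EA CD).
- by move=> al mu rho chi k l A B C Phi EA ? dj D DD;
  apply/dj/(upd _ _ _ _ EA DD).
- by move=> al mu rho chi k l A B Phi EA ? dj D DD;
  apply/dj/(upd _ _ _ _ EA DD).
- by move=> al mu rho chi k n A B Phi EA ? ? ? dj D DD;
  apply/dj/(upd _ _ _ _ EA DD).
- by move=> al mu rho chi k n A B Phi EA ? ? dj D DD;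
  apply/dj/(upd _ _ _ _ EA DD).
- by move=> al mu rho chi k A B Phi EA ? ? dj D DD;
  apply/dj/(upd _ _ _ _ EA DD).
- move=> al mu rho chi y A R _ _ _ _ _ _ dj B BD.
  by rewrite in_fsetU in_fsetD BD (negPf (dj _ BD)).
Qed.

(** Messages are posted only by Send, SendInfo, SendRelease and In; each of the first three is
    backed by a fact that the sender knew, and In by the receiver being a receptionist. *)
Lemma inbox_step fresh c e c' B m : step fresh c e c' ->
  m \in inbox (undelivered c') B ->
  m \in inbox (undelivered c) B \/
  match m with
  | App x R => [/\ target x = B, forall z, z \in R -> owner z = B
      & knows (actors c) (owner x) (Activated x) \/ B \in receptionists c]
  | Info y x A => [/\ target y = B, target x = B, owner x = A
      & knows (actors c) (owner y) (CreatedUsing y x)]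
  | Release x n => [/\ target x = B, deactivates x e
      & knows (actors c) (owner x) (SentCount x n)]
  end.
Proof.
case=> {c e c'} /=; try by move=> *; left.
- move=> al mu rho chi k yzC A C Phi EA /derives_activated kP _ _ _.
  rewrite mem_post => /orP[/andP[/eqP-> /eqP->]|]; [right|by left].
  split=> //; last by left; rewrite (knows_at _ EA).
  by move=> z /imfsetP[p _ ->].
- by move=> al mu rho chi x C R Phi _ _ /mem_consume; left.
- move=> al mu rho chi k l A D C Phi EA kP.
  rewrite mem_post => /orP[/andP[/eqP-> /eqP->]|]; [right|by left].
  by split; rewrite ?(knows_at _ EA).
- by move=> al mu rho chi x l C D Phi _ _ /mem_consume; left.
- move=> al mu rho chi k n A C Phi EA kP nP _.
  rewrite mem_post => /orP[/andP[/eqP-> /eqP->]|]; [right|by left].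
  by split; rewrite ?(knows_at _ EA) /=.
- by move=> al mu rho chi k n A C Phi _ _ _ /mem_consume; left.
- move=> al mu rho chi x A R Arho _ xA RA _ _.
  rewrite mem_post => /orP[/andP[/eqP-> /eqP->]|]; [right|by left].
  by split=> //; [move=> z /RA[]|right].
- by move=> al mu rho chi x C R _ _ /mem_consume; left.
- by move=> al mu rho chi x n C _ _ /mem_consume; left.
- by move=> al mu rho chi x y C D _ _ /mem_consume; left.
Qed.

Definition well_addressed c := forall B m, m \in inbox (undelivered c) B ->
  match m with
  | App x R => target x = B /\ forall z, z \in R -> owner z = B
  | Info y _ _ => target y = B
  | Release x _ => target x = B
  end.

Lemma well_addressed_step fresh c e c' : step fresh c e c' ->
  well_addressed c -> well_addressed c'.
Proof.
move=> st wa B m /(inbox_step st)[/wa//|].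
by case: m => [x R|y x A|x n] [].
Qed.

Lemma sends_along_step fresh c e c' x : step fresh c e c' -> sends_along x e ->
  owner x \in externals c \/
  exists Phi, (actors c).[? owner x] = Some (Busy Phi) /\
    (Activated x \in Phi \/ exists y, CreatedUsing x y \in Phi).
Proof.
case=> {c e c'} //=.
- move=> al mu rho chi k yzC A B Phi EA /derives_activated kP _ _ _ /eqP<-.
  by right; exists Phi; split=> //; left.
- move=> al mu rho chi k l A B C Phi EA kP /eqP<-.
  by right; exists Phi; split=> //; right; exists (l, B, C).
- by move=> al mu rho chi y A R _ ychi _ _ _ _ /eqP<-; left.
Qed.

(** Conservation of messages along [x]. It is an inequality because external actors consume messages
    without a counted reception; [well_addressed] ensures that a reception empties the mailbox of
    [target x]. *)
Lemma flow_step fresh c e c' x : step fresh c e c' -> well_addressed c ->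
  pending (along x) (undelivered c') (target x) + receives_along x e
  <= pending (along x) (undelivered c) (target x) + sends_along x e.
Proof.
case=> {c e c'} /=; try by move=> *; rewrite ?addn0.
- move=> al mu rho chi k yzC A B Phi EA _ _ _ _ _.
  by rewrite pending_post /=; case: eqP => _; lia.
- move=> al mu rho chi y B R Phi EB yR /(_ _ _ yR)[/= Ey _].
  rewrite (pending_consume (along x) (target x) yR) /=.
  by case: eqP => [<-|_]; rewrite ?andbF ?Ey ?eqxx /=; lia.
- move=> al mu rho chi k l A B C Phi EA _ _.
  by rewrite pending_post /=; case: eqP => _; lia.
- move=> al mu rho chi y l A C Phi EB yR /(_ _ _ yR) /= Ey.
  rewrite (pending_consume (along x) (target x) yR) /=.
  by case: eqP => [<-|_]; rewrite ?andbF ?Ey ?eqxx /=; lia.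
- by move=> al mu rho chi k n A B Phi _ _ _ _ _; rewrite pending_post andbF.
- move=> al mu rho chi k n A B Phi _ yR _ _.
  by rewrite (pending_consume _ _ yR); lia.
- move=> al mu rho chi y A R _ _ yA _ _ _ _.
  by rewrite pending_post /=; case: eqP => _; lia.
- by move=> al mu rho chi y B R _ yR _; rewrite (pending_consume _ _ yR); lia.
- by move=> al mu rho chi y n B _ yR _; rewrite (pending_consume _ _ yR); lia.
- by move=> al mu rho chi y z B C _ yR _; rewrite (pending_consume _ _ yR); lia.
Qed.

Lemma release_flow_step fresh c e c' x : step fresh c e c' ->
  pending (releases x) (undelivered c') (target x) + frees x e
  <= pending (releases x) (undelivered c) (target x) + deactivates x e.
Proof.
case=> {c e c'} /=; try by move=> *; rewrite ?addn0.
- move=> al mu rho chi k yzC A B Phi EA _ _ _ _.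
  by rewrite pending_post andbF.
- move=> al mu rho chi y B R Phi EB yR.
  by rewrite (pending_consume _ _ yR); lia.
- by move=> al mu rho chi k l A B C Phi EA _; rewrite pending_post andbF.
- move=> al mu rho chi y l A C Phi EB yR.
  by rewrite (pending_consume _ _ yR); lia.
- move=> al mu rho chi k n A B Phi _ _ _ _; rewrite pending_post /=.
  by case: ((k, A, B) == x); case: eqP => _ /=; lia.
- move=> al mu rho chi k n A B Phi _ yR _.
  rewrite (pending_consume (releases x) (target x) yR) /=.
  by case: eqP => [<-|_]; rewrite ?eqxx ?andbF /=; lia.
- by move=> al mu rho chi y A R _ _ yA _ _ _; rewrite pending_post andbF.
- by move=> al mu rho chi y B R _ yR; rewrite (pending_consume _ _ yR); lia.
- by move=> al mu rho chi y n B _ yR; rewrite (pending_consume _ _ yR); lia.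
- by move=> al mu rho chi y z B C _ yR; rewrite (pending_consume _ _ yR); lia.
Qed.

(** * Gain and loss of facts *)

Definition is_count f : bool :=
  match f with SentCount _ _ | RecvCount _ _ => true | _ => false end.

Lemma not_sent_count x f : ~~ is_count f -> ~~ is_sent_count x f.
Proof. by case: f. Qed.

Lemma not_recv_count x f : ~~ is_count f -> ~~ is_recv_count x f.
Proof. by case: f. Qed.

(** Facts other than counts are lost only by Compaction, SendRelease and SendInfo; each alternative
    records the precondition or the effect of the event that is exploited later. *)
Lemma knows_kept fresh c e c' A f : step fresh c e c' ->
  knows (actors c) A f ->
  knows (actors c') A f \/
  match f with
  | Created x => knows (actors c) A (Released x)
  | Activated x =>
      deactivates x e /\ forall y, ~~ knows (actors c) A (CreatedUsing x y)
  | CreatedUsing y x =>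
      sends_along y e /\ Info y x (owner x) \in inbox (undelivered c') (target
        x)
  | _ => True
  end.
Proof.
have [cf|ncf] := boolP (is_count f); first by case: f cf; right.
case=> {c e c'} /=; try by move=> *; left.
- move=> al mu rho chi k l C B Phi EA _ _ _ nB _ xP; left.
  rewrite !knows_set; case: eqP => [EB|_].
    by rewrite -EB (knows_domf xP) in nB.
  case: eqP xP => // ->; rewrite (knows_at _ EA) /= => xP.
  by rewrite in_fset1U xP orbT.
- move=> al mu rho chi k yzC C B Phi EA _ _ _ _ xP; left.
  rewrite knows_set; case: eqP xP => // ->; rewrite (knows_at _ EA) /= => xP.
  by rewrite in_fsetU mem_IncSent ?xP ?not_sent_count.
- move=> al mu rho chi y B R Phi EA _ xP; left.
  rewrite knows_set; case: eqP xP => // ->; rewrite (knows_at _ EA) /= => xP.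
  by rewrite in_fsetU mem_IncRecv ?xP ?not_recv_count.
- move=> al mu rho chi C Phi EA xP; left.
  by rewrite knows_set; case: eqP xP => // ->; rewrite (knows_at _ EA).
- move=> al mu rho chi k l D B C Phi EA kP.
  rewrite knows_set; case: eqP => [->|_ ->]; last by left.
  rewrite (knows_at _ EA) /= mem_IncSent ?not_sent_count // in_fsetD1 => fP.
  case: eqP => [->|_]; last by left.
  by right; rewrite mem_post !eqxx.
- move=> al mu rho chi y k B C Phi EA _ xP; left.
  rewrite knows_set; case: eqP xP => // ->; rewrite (knows_at _ EA) /= => xP.
  by rewrite in_fset1U mem_IncRecv ?not_recv_count // xP orbT.
- move=> al mu rho chi k n D B Phi EA kP _ nCU.
  rewrite knows_set; case: eqP => [->|_ ->]; last by left.
  rewrite (knows_at _ EA) /= !in_fsetD1 => ->; rewrite andbT.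
  have -> /= : f != SentCount (k, D, B) n by case: (f) ncf.
  case: eqP => [->|_]; last by left.
  by right; split=> // y; rewrite (knows_at _ EA) nCU.
- move=> al mu rho chi k n D B Phi EA _ _ xP; left.
  rewrite knows_set; case: eqP xP => // ->; rewrite (knows_at _ EA) /= => xP.
  by rewrite in_fset1U xP orbT.
- move=> al mu rho chi k B C Phi EA CP RP.
  rewrite knows_set; case: eqP => [->|_ ->]; last by left.
  rewrite (knows_at _ EA) /= mem_compaction not_recv_count // andbT => ->.
  case: eqP => [->|_]; first by right; rewrite (knows_at _ EA).
  by case: eqP => [->|_]; [right|left].
Qed.

Lemma knows_new fresh c e c' A f : step fresh c e c' ->
  knows (actors c') A f ->
  knows (actors c) A f \/
  match f with
  | Released x => frees x e
  | CreatedUsing y x => x \in created_by e /\ knows (actors c) A (Activated y)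
  | _ => True
  end.
Proof.
have [cf|ncf] := boolP (is_count f); first by case: f cf; right.
case=> {c e c'} /=; try by move=> *; left.
- move=> al mu rho chi k l C B Phi EA _ _ _ nB _ .
  rewrite !knows_set; case: eqP => [EB|_] /=.
    by rewrite !(in_fset1U, in_fset1, in_fsetU) -orbA => /or3P[]/eqP->; right.
  case: eqP => [->|_]; last by left.
  by rewrite ?(knows_at _ EA) /= in_fset1U => /predU1P[->|]; [right|left].
- move=> al mu rho chi k yzC C B Phi EA _ yP _ _.
  rewrite knows_set; case: eqP => [->|_]; last by left.
  rewrite (knows_at _ EA) /= in_fsetU mem_IncSent ?not_sent_count //.
  case/orP; first by left.
  case/mem_created_using => k' [l [D [klC ->]]]; right; split.
    by apply/imfsetP; exists (k', l, D).
  by rewrite (knows_at _ EA) /=; exact/derives_activated/(yP _ _ _ klC).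
- move=> al mu rho chi z B R Phi EA _.
  rewrite knows_set; case: eqP => [->|_]; last by left.
  rewrite (knows_at _ EA) /= in_fsetU mem_IncRecv ?not_recv_count //.
  by rewrite mem_activated => /orP[]; [left|case: (f); right].
- move=> al mu rho chi C Phi EA.
  by rewrite knows_set; case: eqP => [->|_]; rewrite ?(knows_at _ EA); left.
- move=> al mu rho chi k l D B C Phi EA _.
  rewrite knows_set; case: eqP => [->|_]; last by left.
  by rewrite (knows_at _ EA) /= mem_IncSent ?not_sent_count // in_fsetD1 =>
    /andP[]; left.
- move=> al mu rho chi z k B C Phi EA _.
  rewrite knows_set; case: eqP => [->|_]; last by left.
  rewrite (knows_at _ EA) /= in_fset1U mem_IncRecv ?not_recv_count //.
  by case/predU1P => [->|]; [right|left].
- move=> al mu rho chi k n D B Phi EA _ _ _.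
  rewrite knows_set; case: eqP => [->|_]; last by left.
  by rewrite (knows_at _ EA) /= !in_fsetD1 => /and3P[]; left.
- move=> al mu rho chi k n D B Phi EA _ _.
  rewrite knows_set; case: eqP => [->|_]; last by left.
  by rewrite (knows_at _ EA) /= in_fset1U => /predU1P[->|]; [right|left].
- move=> al mu rho chi k B C Phi EA _ _.
  rewrite knows_set; case: eqP => [->|_]; last by left.
  by rewrite (knows_at _ EA) /= mem_compaction => /andP[]; left.
Qed.

(** An internal actor consumes this message only by an Info event, which turns it into [Created x];
    an external one drops it. *)
Lemma info_kept fresh c e c' x y B : step fresh c e c' ->
  Info y x (owner x) \in inbox (undelivered c) B ->
  [\/ Info y x (owner x) \in inbox (undelivered c') B,
      knows (actors c') B (Created x) | B \in externals c].
Proof.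
case=> {c e c'} /=; try by move=> *; apply: Or31.
- by move=> al mu rho chi k yzC A C Phi *; apply: Or31; rewrite mem_post;
  apply/orP; right.
- move=> al mu rho chi z C R Phi _ _ m_in; apply: Or31.
  by case: (consume_other C (App z R) m_in) => // /andP[_ /eqP].
- by move=> al mu rho chi k l A D C *; apply: Or31; rewrite mem_post;
  apply/orP; right.
- move=> al mu rho chi z k D C Phi _ _ m_in.
  case: (consume_other C (Info z (k, D, C) D) m_in) => [|]; last exact: Or31.
  case/andP=> /eqP-> /eqP[_ -> _]; apply: Or32.
  by rewrite knows_set eqxx /= in_fset1U eqxx.
- by move=> al mu rho chi k l A *; apply: Or31; rewrite mem_post; apply/orP;
  right.
- move=> al mu rho chi k n A C Phi _ _ _ m_in; apply: Or31.
  by case: (consume_other C (Release (k, A, C) n) m_in) => // /andP[_ /eqP].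
- by move=> al mu rho chi k l A *; apply: Or31; rewrite mem_post; apply/orP;
  right.
- move=> al mu rho chi z C R _ _ m_in; apply: Or31.
  by case: (consume_other C (App z R) m_in) => // /andP[_ /eqP].
- move=> al mu rho chi z n C _ _ m_in; apply: Or31.
  by case: (consume_other C (Release z n) m_in) => // /andP[_ /eqP].
- move=> al mu rho chi z w D C Cchi _ m_in.
  case: (consume_other C (Info z w D) m_in) => [|]; last exact: Or31.
  by case/andP=> /eqP-> _; apply: Or33.
Qed.

(** SendRelease erases the stored count, and sends of an external owner are stored nowhere; the
    hypotheses exclude both. *)
Lemma sent_count_step fresh c e c' x k : step fresh c e c' ->
    owner x \notin externals c -> ~~ deactivates x e ->
    (forall n, knows (actors c) (owner x) (SentCount x n) =
               (n == k) && (0 < n)) ->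
  forall n, knows (actors c') (owner x) (SentCount x n) =
            (n == k + sends_along x e) && (0 < n).
Proof.
have inc Phi (A B : Actor) l n :
    (forall i, (SentCount x i \in Phi) = (i == k) && (0 < i)) ->
  (SentCount x n \in IncSent (l, A, B) Phi) =
  (n == k + ((l, A, B) == x)) && (0 < n).
  move=> Pk; case: (eqVneq (l, A, B) x) => [->|nx]; last first.
    by rewrite mem_IncSent /= ?Pk ?addn0 // eq_sym.
  by rewrite (mem_IncSent_count _ Pk) addn1; case: n => //= n; rewrite andbT.
case=> {c e c'} /=; try by move=> *; rewrite addn0.
- move=> al mu rho chi l l' A B Phi EA _ _ _ nB _ _ _ Pk n; rewrite addn0.
  rewrite !knows_set; case: eqP => [EB|_].
    rewrite -Pk EB -[RHS]negbK (contra (@knows_domf _ _ _) nB).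
    by rewrite /= !(in_fset1U, in_fset1, in_fsetU) !eq_factE.
  by rewrite -Pk; case: eqP => [->|//];
    rewrite (knows_at _ EA) /= in_fset1U eq_factE.
- move=> al mu rho chi l yzC A B Phi EA _ _ _ _ _ _ Pk n.
  rewrite knows_set; case: eqP => [E|/eqP nA].
    rewrite /= in_fsetU created_using_only // orbF; apply: inc => i.
    by rewrite -Pk E (knows_at _ EA).
  rewrite Pk; case: (eqVneq (l, A, B) x) => [Ex|_]; last by rewrite addn0.
  by rewrite -Ex /= eqxx in nA.
- move=> al mu rho chi y B R Phi EA _ _ _ Pk n; rewrite addn0 -Pk knows_set.
  case: eqP => [->|//]; rewrite (knows_at _ EA) /= in_fsetU mem_activated orbF.
  by rewrite mem_IncRecv.
- move=> al mu rho chi A Phi EA _ _ Pk n; rewrite addn0 -Pk knows_set.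
  by case: eqP => [->|//]; rewrite (knows_at _ EA).
- move=> al mu rho chi l l' A B C Phi EA _ _ _ Pk n.
  rewrite knows_set; case: eqP => [E|/eqP nA].
    apply: inc => i.
    by rewrite -Pk E (knows_at _ EA) in_fsetD1 eq_factE.
  rewrite Pk; case: (eqVneq (l, A, C) x) => [Ex|_]; last by rewrite addn0.
  by rewrite -Ex /= eqxx in nA.
- move=> al mu rho chi y l B C Phi EA _ _ _ Pk n; rewrite addn0 -Pk knows_set.
  case: eqP => [->|//]; rewrite (knows_at _ EA) /= in_fset1U eq_factE.
  by rewrite mem_IncRecv.
- move=> al mu rho chi l i A B Phi EA _ _ _ _ nx Pk n;
  rewrite addn0 -Pk knows_set.
  case: eqP => [->|//]; rewrite (knows_at _ EA) /= !in_fsetD1 !eq_factE /=.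
  by rewrite eq_sym (negPf nx).
- move=> al mu rho chi l i A B Phi EA _ _ _ _ Pk n; rewrite addn0 -Pk knows_set.
  by case: eqP => [->|//]; rewrite (knows_at _ EA) /= in_fset1U eq_factE.
- move=> al mu rho chi l B C Phi EA _ _ _ _ Pk n; rewrite addn0 -Pk knows_set.
  case: eqP => [->|//]; rewrite (knows_at _ EA) /= mem_compaction !eq_factE /=.
  by rewrite andbT.
- move=> al mu rho chi y A R _ ychi _ _ _ _ nchi _ Pk n; rewrite Pk.
  by case: (eqVneq y x) nchi => [<-|_]; rewrite ?ychi ?addn0.
Qed.

(** Only Compaction erases a receive count, and it requires [Released x]. *)
Lemma recv_count_step fresh c e c' x k : step fresh c e c' ->
  well_addressed c ->
    ~~ knows (actors c) (target x) (Released x) ->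
    (forall n, knows (actors c) (target x) (RecvCount x n) =
               (n == k) && (0 < n)) ->
  forall n, knows (actors c') (target x) (RecvCount x n) =
            (n == k + receives_along x e) && (0 < n).
Proof.
have inc Phi y n : (forall i, (RecvCount x i \in Phi) = (i == k) && (0 < i)) ->
    (RecvCount x n \in IncRecv y Phi) = (n == k + (y == x)) && (0 < n).
  move=> Pk; case: (eqVneq y x) => [->|nx]; last first.
    by rewrite mem_IncRecv /= ?Pk ?addn0 // eq_sym.
  by rewrite (mem_IncRecv_count _ Pk) addn1; case: n => //= n; rewrite andbT.
case=> {c e c'} /=; try by move=> *; rewrite addn0.
- move=> al mu rho chi l l' A B Phi EA _ _ _ nB _ _ _ Pk n; rewrite addn0.
  rewrite !knows_set; case: eqP => [EB|_].
    rewrite -Pk EB -[RHS]negbK (contra (@knows_domf _ _ _) nB).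
    by rewrite /= !(in_fset1U, in_fset1, in_fsetU) !eq_factE.
  by rewrite -Pk; case: eqP => [->|//];
    rewrite (knows_at _ EA) /= in_fset1U eq_factE.
- move=> al mu rho chi l yzC A B Phi EA _ _ _ _ _ _ Pk n; rewrite addn0 -Pk.
  rewrite knows_set; case: eqP => [->|//]; rewrite (knows_at _ EA) /=.
  by rewrite in_fsetU created_using_only // orbF mem_IncSent.
- move=> al mu rho chi y B R Phi EA yR /(_ _ _ yR)[/= yB _] _ Pk n.
  rewrite knows_set; case: eqP => [E|/eqP nB].
    rewrite /= in_fsetU mem_activated orbF; apply: inc => i.
    by rewrite -Pk E (knows_at _ EA).
  rewrite Pk; case: (eqVneq y x) => [Ex|_]; last by rewrite addn0.
  by rewrite -Ex yB eqxx in nB.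
- move=> al mu rho chi A Phi EA _ _ Pk n; rewrite addn0 -Pk knows_set.
  by case: eqP => [->|//]; rewrite (knows_at _ EA).
- move=> al mu rho chi l l' A B C Phi EA _ _ _ Pk n;
  rewrite addn0 -Pk knows_set.
  case: eqP => [->|//]; rewrite (knows_at _ EA) /= mem_IncSent //.
  by rewrite in_fsetD1 eq_factE.
- move=> al mu rho chi y l B C Phi EA yP /(_ _ _ yP) /= yC _ Pk n.
  rewrite knows_set; case: eqP => [E|/eqP nC].
    rewrite /= in_fset1U eq_factE; apply: inc => i.
    by rewrite -Pk E (knows_at _ EA).
  rewrite Pk; case: (eqVneq y x) => [Ex|_]; last by rewrite addn0.
  by rewrite -Ex yC eqxx in nC.
- move=> al mu rho chi l i A B Phi EA _ _ _ _ _ Pk n;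
  rewrite addn0 -Pk knows_set.
  by case: eqP => [->|//]; rewrite (knows_at _ EA) /= !in_fsetD1 !eq_factE.
- move=> al mu rho chi l i A B Phi EA _ _ _ _ Pk n; rewrite addn0 -Pk knows_set.
  by case: eqP => [->|//]; rewrite (knows_at _ EA) /= in_fset1U eq_factE.
- move=> al mu rho chi l B C Phi EA _ RP _ nx Pk n; rewrite addn0 -Pk knows_set.
  case: eqP => [E|//]; rewrite E (knows_at _ EA) /= mem_compaction !eq_factE /=.
  case: eqP => [Ex|]; last by rewrite andbT.
  by rewrite Ex (knows_at _ EA) RP in nx.
Qed.

(** * Deactivation, release and creation of refobs *)

Lemma deactivates_step fresh c e c' x : step fresh c e c' -> deactivates x e ->
  knows (actors c) (owner x) (Activated x).
Proof.
case=> {c e c'} //= al mu rho chi k n A B Phi EA kP _ _ /eqP<-.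
by rewrite (knows_at _ EA).
Qed.

Lemma frees_step fresh c e c' x : step fresh c e c' -> frees x e ->
  exists n Phi, [/\ (actors c).[? target x] = Some (Idle Phi),
    Release x n \in inbox (undelivered c) (target x) & derives Phi (RecvCount
      x n)].
Proof.
case=> {c e c'} //= al mu rho chi k n A B Phi EB xn dn /eqP<-.
by exists n, Phi.
Qed.

Lemma born_fresh fresh c e c' x : step fresh c e c' -> x \in created_by e ->
  fresh (token x).
Proof.
case=> {c e c'} //=.
- move=> al mu rho chi k l A B Phi _ fk fl _ _ _.
  by rewrite !(in_fset1U, in_fset1, in_fsetU) => /orP[]/eqP->.
- move=> al mu rho chi k yzC A B Phi _ _ _ zP _ /imfsetP[[[y z] C] /= yzP ->].
  exact: zP yzP.
- by move=> al mu rho chi y A R _ _ _ RA _ _ /RA[].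
Qed.

(** Together with [born_fresh], this prevents a second creation of the same refob. *)
Lemma born_mentions fresh c e c' x : step fresh c e c' -> x \in created_by e ->
  mentions c' x.
Proof.
case=> {c e c'} //=.
- move=> al mu rho chi k l A B Phi _ _ _ _ _ _.
  rewrite !(in_fset1U, in_fset1, in_fsetU) => /orP[]/eqP->; left; exists B;
    eexists.
    exists (Created (k, A, B)); split; first by rewrite fnd_set eqxx.
      by rewrite /= !(in_fset1U, in_fset1, in_fsetU) eqxx.
    by rewrite /= mem_head.
  exists (Created (l, B, B)); split; first by rewrite fnd_set eqxx.
    by rewrite /= !(in_fset1U, in_fset1, in_fsetU) eqxx orbT.
  by rewrite /= mem_head.
- move=> al mu rho chi k yzC A B Phi _ _ _ _ _ xR; right.
  exists B, (App (k, A, B) [fset (p.1.2, B, p.2) | p in yzC]); split;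
    first by rewrite mem_post !eqxx.
  by rewrite /= in_cons xR orbT.
- move=> al mu rho chi y A R _ _ _ _ _ _ xR; right.
  exists A, (App y R); split; first by rewrite mem_post !eqxx.
  by rewrite /= in_cons xR orbT.
Qed.

(** The alternatives correspond to Spawn, Send and In, in this order. *)
Lemma born_step fresh c e c' x : step fresh c e c' -> x \in created_by e ->
  [\/ target x \notin domf (actors c) /\ knows (actors c') (target x) (Created
    x),
      exists y, [/\ target y = target x,
        knows (actors c) (owner y) (Activated y)
        & knows (actors c') (owner y) (CreatedUsing y x)]
    | target x \in receptionists c \/ target x \in externals c'].
Proof.
case=> {c e c'} //=.
- move=> al mu rho chi k l A B Phi _ _ _ _ nB _ xkl; apply: Or31.
  suff E : target x = B.
    rewrite E; split; rewrite // knows_set eqxx /=.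
    move: xkl; rewrite !(in_fset1U, in_fset1, in_fsetU) !eq_factE =>
      /orP[]-> //.
    by rewrite orbT.
  by move: xkl; rewrite !(in_fset1U, in_fset1, in_fsetU) => /orP[]/eqP->.
- move=> al mu rho chi k yzC A B Phi EA _ yP _ _ /imfsetP[[[y z] C] /= yzP ->].
  apply: Or32; exists (y, A, C); split=> //.
    by rewrite (knows_at _ EA); exact/derives_activated/(yP _ _ _ yzP).
  rewrite knows_set eqxx in_fsetU; apply/orP; right.
  by apply/imfsetP; exists (y, z, C).
- move=> al mu rho chi y A R _ _ _ _ _ RP xR; apply: Or33.
  case: (boolP (target x \in domf al)) => [/(RP _ xR)|nx]; first by left.
  right; rewrite in_fsetU in_fsetD nx /=; apply/orP; right.
  by apply/imfsetP; exists x.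
Qed.

Definition existing c A : bool := (A \in domf (actors c)) || (A \in externals
  c).

(** In relies on receptionists being internal, Send on the existence of the targets of activated
    refobs. *)
Lemma born_existing fresh c e c' x : step fresh c e c' -> x \in created_by e ->
    {subset receptionists c <= domf (actors c)} ->
    (forall y, knows (actors c) (owner y) (Activated y) ->
      existing c (target y)) ->
  existing c' (owner x) /\ existing c' (target x).
Proof.
rewrite /existing; case=> {c e c'} //=.
- move=> al mu rho chi k l A B Phi EA _ _ _ _ _ + _ _.
  have AD := some_domf EA.
  rewrite !(in_fset1U, in_fset1, in_fsetU).
  by case/orP=> /eqP->; rewrite /owner /target /= ?eqxx ?AD ?orbT.
- move=> al mu rho chi k yzC A B Phi EA kP yP _ _ /imfsetP[[[y z] C] /= yzP ->].
  have Adom D : (D \in domf al) || (D \in chi) ->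
    (D \in A |` domf al) || (D \in chi).
    by rewrite in_fset1U => /orP[]->; rewrite !orbT.
  move=> _ ex; rewrite /owner /target /=; split; apply: Adom.
    by apply: (ex (k, A, B)); rewrite (knows_at _ EA); apply: derives_activated.
  by apply: (ex (y, A, C)); rewrite (knows_at _ EA);
    apply/derives_activated/(yP _ _ _ yzP).
- move=> al mu rho chi y A R Arho _ _ RP _ _ xR sub _.
  have [_ ->] := RP _ xR; split; first by rewrite sub.
  case: (boolP (target x \in domf al)) => //= nx.
  rewrite in_fsetU in_fsetD nx /=; apply/orP; right.
  by apply/imfsetP; exists x.
Qed.

(** An idle actor without messages can only take a snapshot or compact, and compaction never removes
    an [Activated] fact. *)
Lemma blocked_step fresh c e c' A Phi : step fresh c e c' ->
    (actors c).[? A] = Some (Idle Phi) -> A \notin receptionists c ->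
    inbox (undelivered c) A = mset0 ->
  exists2 Phi', (actors c').[? A] = Some (Idle Phi')
    & {subset Phi' <= Phi} /\ forall x, Activated x \in Phi ->
      Activated x \in Phi'.
Proof.
have keep : {subset Phi <= Phi} /\ forall x, Activated x \in Phi ->
  Activated x \in Phi.
  by split.
have busy al B s : al.[? B] = Some (Busy s) -> al.[? A] = Some (Idle Phi) ->
  A != B.
  by move=> EB EA; apply/eqP => E; move: EA; rewrite E EB.
have full mu B m : m \in inbox mu B -> inbox mu A = mset0 -> A != B.
  by move=> mB mA; apply: contraTneq mB => <-; rewrite mA in_mset0.
case=> {c e c'} /=; try by move=> *; exists Phi.
- move=> al mu rho chi k l C B Psi EC _ _ _ nB _ EA _ _; exists Phi => //.
  rewrite !fnd_set (negPf (busy _ _ _ EC EA)); case: eqP => // EB.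
  by rewrite -EB (some_domf EA) in nB.
- move=> al mu rho chi k yzC C B Psi EC _ _ _ _ EA _ _; exists Phi => //.
  by rewrite fnd_set (negPf (busy _ _ _ EC EA)).
- move=> al mu rho chi y B R Psi EB yR EA _ A0; exists Phi => //.
  by rewrite fnd_set (negPf (full _ _ _ yR A0)).
- move=> al mu rho chi C Psi EC EA _ _; exists Phi => //.
  by rewrite fnd_set (negPf (busy _ _ _ EC EA)).
- move=> al mu rho chi k l C B D Psi EC _ EA _ _; exists Phi => //.
  by rewrite fnd_set (negPf (busy _ _ _ EC EA)).
- move=> al mu rho chi y l B C Psi EB yR EA _ A0; exists Phi => //.
  by rewrite fnd_set (negPf (full _ _ _ yR A0)).
- move=> al mu rho chi k n C B Psi EC _ _ _ EA _ _; exists Phi => //.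
  by rewrite fnd_set (negPf (busy _ _ _ EC EA)).
- move=> al mu rho chi k n C B Psi EB yR _ EA _ A0; exists Phi => //.
  by rewrite fnd_set (negPf (full _ _ _ yR A0)).
- move=> al mu rho chi k B C Psi EC _ _ EA _ _; rewrite fnd_set.
  case: eqP => [E|_]; last by exists Phi.
  move: EA; rewrite E EC => -[->]; eexists; first by [].
  split=> [f|x xP]; first by rewrite mem_compaction => /andP[].
  by rewrite mem_compaction xP !eq_factE.
Qed.

Lemma snapshot_step fresh c A Phi c' : step fresh c (ESnapshot A Phi) c' ->
  (actors c).[? A] = Some (Idle Phi) /\ c' = c.
Proof. by move=> st; inversion st. Qed.

(** * Invariants of executions *)

Context (len : option nat) (conf : nat -> config Token Actor).
Context (evt : nat -> event Token Actor).
Context (exec : execution len conf evt).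

Implicit Types (q : pred (event Token Actor)).

(** * Counting events up to a time *)

Definition tally (q : pred (event Token Actor)) t := \sum_(s < t) q (evt s).

(* At time 0 the existing refobs are exactly those activated by their owner. *)
Definition births x t :=
  knows (actors (conf 0)) (owner x) (Activated x) +
  tally (fun e => x \in created_by e) t.
Definition sends x := tally (sends_along x).
Definition recvs x := tally (receives_along x).
Definition deacts x := tally (deactivates x).
Definition rels x := tally (frees x).

Lemma tally0 q : tally q 0 = 0.
Proof. by rewrite /tally big_ord0. Qed.

Lemma tallyS q t : tally q t.+1 = tally q t + q (evt t).
Proof. by rewrite /tally big_ord_recr. Qed.

Lemma leq_tally q s t : s <= t -> tally q s <= tally q t.
Proof.
elim: t => [|t IH]; first by rewrite leqn0 => /eqP->.
rewrite leq_eqVlt => /predU1P[->//|/IH]; rewrite tallyS; lia.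
Qed.

Lemma tally_gt0 q t : 0 < tally q t -> exists2 s, s < t & q (evt s).
Proof.
elim: t => [|t IH]; rewrite ?tally0 // tallyS.
case qt: (q (evt t)) => /=; first by exists t.
by rewrite addn0 => /IH[s lt_st qs]; exists s; rewrite // ltnW.
Qed.

Lemma tally_has q s t : s < t -> q (evt s) -> 0 < tally q t.
Proof.
by move=> /(leq_tally q) + qs; apply: leq_trans; rewrite tallyS qs addn1.
Qed.

Lemma birthsS x t : births x t.+1 = births x t + (x \in created_by (evt t)).
Proof. by rewrite /births tallyS addnA. Qed.

Lemma leq_births x s t : s <= t -> births x s <= births x t.
Proof. by move=> le_st; rewrite leq_add2l leq_tally. Qed.

Lemma timeW s t : s <= t -> is_time len t -> is_time len s.
Proof. by case: len => //= n; apply: leq_trans. Qed.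

Lemma exec_step t : is_time len t.+1 ->
  step (fresh_at conf t) (conf t) (evt t) (conf t.+1).
Proof. exact: exec.2. Qed.

(** Induction that stays inside the execution, where [exec_step] applies. *)
Lemma time_ind (P : nat -> Prop) : P 0 ->
    (forall t, is_time len t.+1 -> is_time len t -> P t -> P t.+1) ->
  forall t, is_time len t -> P t.
Proof.
move=> P0 PS; elim=> // t IH tS; have tt := timeW (leqnSn t) tS.
exact/PS/IH.
Qed.

(** * The initial configuration *)

Lemma initial_inbox B : inbox (undelivered (conf 0)) B = mset0.
Proof.
by case: exec => -[x [y [A [E [_ _ ->]]]]] _; rewrite /inbox /= fsfunE.
Qed.

Lemma initial_pending p B : pending p (undelivered (conf 0)) B = 0.
Proof. by rewrite /pending initial_inbox enum_mset0. Qed.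

Lemma initial_receptionists : receptionists (conf 0) = fset0.
Proof. by case: exec => -[x [y [A [E [_ _ ->]]]]]. Qed.

Lemma initial_disjoint A : A \in domf (actors (conf 0)) ->
  A \notin externals (conf 0).
Proof.
case: exec => -[x [y [C [E [_ CE ->]]]]] _ /=.
by rewrite in_fset1U in_fset0 orbF in_fset1 => /eqP->.
Qed.

Lemma initial_knows A f : knows (actors (conf 0)) A f ->
  exists k l E,
    [/\ f \in [fset Activated (k, A, E); Created (l, A, A);
      Activated (l, A, A)],
     E \in externals (conf 0) & knows (actors (conf 0)) A (Created (l, A, A))].
Proof.
case: exec => -[k [l [C [E [_ CE ->]]]]] _ /=.
rewrite knows_set /=; case: eqP => [->|_]; last by rewrite /knows fnd_fmap0.
move=> fP; exists k, l, E.
by split; rewrite // ?knows_set ?eqxx /= !(in_fset1U, in_fset1,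
  in_fsetU) eqxx ?orbT.
Qed.

Lemma initial_mentions x : mentions (conf 0) x <-> 0 < births x 0.
Proof.
rewrite /births tally0 addn0 lt0b; split.
- case=> [[A [s [f [EA fs xf]]]]|[A [m []]]];
  last by rewrite initial_inbox in_mset0.
  have : knows (actors (conf 0)) A f by rewrite (knows_at _ EA).
  case: exec EA => -[k [l [C [E [_ CE ->]]]]] _ /= EA.
  rewrite !knows_set; case: eqP => [_|_]; last by rewrite {1}/knows fnd_fmap0.
  rewrite /= !(in_fset1U, in_fset1, in_fsetU) => fP.
  have {f fP xf fs} Ex : x = (k, C, E) \/ x = (l, C, C).
    by case/orP: fP xf => [/orP[]|] /eqP-> /=; rewrite inE => /eqP->;
      [left|right..].
  by case: Ex => ->; rewrite /owner /= !eqxx ?orbT.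
- rewrite /knows; case Es: _.[? _] => [s|//] xs; left.
  by exists (owner x), s, (Activated x); split; rewrite //= mem_head.
Qed.

Lemma created_beforeP t x : created_before conf evt t x <-> 0 < births x t.
Proof.
rewrite /created_before initial_mentions; split=> [[b0|[s lt_st xs]]|].
- exact: leq_trans b0 (leq_births _ _).
- by rewrite /births ltn_addl // (@tally_has _ s).
- rewrite {1}/births addn_gt0 => /orP[b0|/tally_gt0[s]]; last by right;
  exists s.
  by left; rewrite /births ltn_addr.
Qed.

Lemma released_beforeP t x : released_before evt t x <-> 0 < rels x t.
Proof.
split=> [[s lt_st Es]|/tally_gt0[s lt_st]].
  by apply: (@tally_has _ s); rewrite // Es /=; case: x {Es} => -[? ?] ? /=.
by case Es: (evt s) => //= [k A B] /eqP Ex; exists s; rewrite // Es -Ex.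
Qed.

(** * Persistence of actors and addressing of messages *)

Lemma domf_mono s t : s <= t -> is_time len t ->
  {subset domf (actors (conf s)) <= domf (actors (conf t))}.
Proof.
move=> + tt; elim/time_ind: t / tt => [|t tS tt IH].
  by rewrite leqn0 => /eqP->.
rewrite leq_eqVlt => /predU1P[->//|/IH sub] A /sub.
exact: domf_step (exec_step tS) _.
Qed.

Lemma externals_mono s t : s <= t -> is_time len t ->
  {subset externals (conf s) <= externals (conf t)}.
Proof.
move=> + tt; elim/time_ind: t / tt => [|t tS tt IH].
  by rewrite leqn0 => /eqP->.
rewrite leq_eqVlt => /predU1P[->//|/IH sub] A /sub.
exact: externals_step (exec_step tS) _.
Qed.

Lemma internal_not_external t : is_time len t ->
  forall A, A \in domf (actors (conf t)) -> A \notin externals (conf t).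
Proof.
elim/time_ind: t / => [|t tS tt IH]; first exact: initial_disjoint.
exact: disjoint_step (exec_step tS) IH.
Qed.

Lemma addressed t : is_time len t -> well_addressed (conf t).
Proof.
elim/time_ind: t / => [B m|t tS tt IH]; first by rewrite initial_inbox in_mset0.
exact: well_addressed_step (exec_step tS) IH.
Qed.

(* The right to use a refob is never duplicated: once created, the refob is in
   one pending message, or activated, or deactivated for good. *)
Lemma budget t x : is_time len t ->
  pending (carries x) (undelivered (conf t)) (owner x)
    + knows (actors (conf t)) (owner x) (Activated x) + deacts x t
  <= births x t.
Proof.
elim/time_ind: t / => [|t tS tt IH].
  by rewrite initial_pending /births /deacts !tally0 !addn0.
have := budget_step x (exec_step tS);
  rewrite birthsS /deacts tallyS -/(deacts x t); lia.
Qed.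

(** * Each refob is created at most once *)

Lemma births_mentioned t x : is_time len t -> 0 < births x t ->
  exists2 s, s <= t & mentions (conf s) x.
Proof.
move=> tt; rewrite /births addn_gt0 => /orP[b0|/tally_gt0[s lt_st xs]].
  by exists 0 => //; apply/initial_mentions; rewrite /births ltn_addr.
exists s.+1 => //; apply: born_mentions xs; exact/exec_step/(timeW lt_st).
Qed.

(** An earlier birth would leave [x] mentioned in some configuration up to time [t], against the
    freshness of its token. *)
Lemma born_new t x : is_time len t.+1 -> x \in created_by (evt t) ->
  births x t = 0.
Proof.
move=> tS xt; apply/eqP; rewrite -leqn0 leqNgt; apply/negP.
case/(births_mentioned (timeW (leqnSn t) tS)) => s le_st xs.
by have /(_ s x le_st xs) := born_fresh (exec_step tS) xt.
Qed.

Lemma births_le1 t x : is_time len t -> births x t <= 1.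
Proof.
elim/time_ind: t / => [|t tS tt IH].
  by rewrite /births tally0 addn0; case: knows.
by rewrite birthsS; case: (boolP (_ \in _)) => [/(born_new tS)->|];
  rewrite ?addn0.
Qed.

Lemma births_inj s t x : is_time len t.+1 -> x \in created_by (evt t) ->
  0 < births x s -> t < s.
Proof.
move=> tS /(born_new tS) b0; apply: contraLR;
  rewrite -leqNgt => /(leq_births x).
by rewrite b0 -eqn0Ngt leqn0.
Qed.

Lemma activated_born t x : is_time len t ->
  knows (actors (conf t)) (owner x) (Activated x) -> 0 < births x t.
Proof. by move=> /(budget x) + xP; rewrite xP; lia. Qed.

(** An earlier deactivation together with the activation would exceed the budget of a single
    creation. *)
Lemma activated_deacts t x : is_time len t ->
  knows (actors (conf t)) (owner x) (Activated x) -> deacts x t = 0.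
Proof. by move=> tt xP; have := budget x tt; have := births_le1 x tt;
  rewrite xP; lia. Qed.

Lemma existing_mono s t A : s <= t -> is_time len t ->
  existing (conf s) A -> existing (conf t) A.
Proof.
move=> le_st tt; rewrite /existing => /orP[/(domf_mono le_st tt)->//|].
by move=> /(externals_mono le_st tt)->; rewrite orbT.
Qed.

Lemma existing_refobs t : is_time len t ->
  {subset receptionists (conf t) <= domf (actors (conf t))} /\
  forall x, 0 < births x t ->
    existing (conf t) (owner x) /\ existing (conf t) (target x).
Proof.
elim/time_ind: t / => [|t tS tt [IHrho IH]].
  split=> [A|x]; first by rewrite initial_receptionists.
  rewrite /births tally0 addn0 lt0b => xP; have AD := knows_domf xP.
  have [k [l [E [fP Echi _]]]] := initial_knows xP; rewrite /existing AD;
    split=> //.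
  move: fP; rewrite !(in_fset1U, in_fset1, in_fsetU) !eq_factE orbF =>
    /orP[]/eqP Ex.
    by rewrite Ex /= Echi orbT.
  by rewrite {1}Ex [target _]/= AD.
have st := exec_step tS; split=> [B|x].
  case/(receptionists_step st) => [/IHrho|]; first exact: domf_step st _.
  by case=> E [y [R [z [_ BD]]]]; apply: domf_step st _ BD.
rewrite birthsS; case: (boolP (_ \in _)) => [xt _|_].
  apply: born_existing st xt IHrho _ => y /(activated_born tt).
  by case/IH.
by rewrite addn0 => /IH[xo xt]; split; apply: (existing_mono (leqnSn t)).
Qed.

Lemma initial_no_count A f : is_count f -> ~~ knows (actors (conf 0)) A f.
Proof.
move=> cf; apply/negP=> /initial_knows[k [l [E [+ _ _]]]].
by rewrite !(in_fset1U, in_fset1, in_fsetU) !eq_factE; case: f cf.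
Qed.

Lemma released_known t A x : is_time len t ->
  knows (actors (conf t)) A (Released x) -> 0 < rels x t.
Proof.
elim/time_ind: t / => [|t tS tt IH].
  case/initial_knows => [k [l [E [+ _ _]]]].
  by rewrite !(in_fset1U, in_fset1, in_fsetU) !eq_factE.
rewrite /rels tallyS -/(rels x t).
by case/(knows_new (exec_step tS)) => [/IH|->]; lia.
Qed.

Lemma sent_counts t x : is_time len t ->
    owner x \notin externals (conf t) -> deacts x t = 0 ->
  forall n, knows (actors (conf t)) (owner x) (SentCount x n) =
            (n == sends x t) && (0 < n).
Proof.
elim/time_ind: t / => [|t tS tt IH] xchi.
  move=> _ n; rewrite (negPf (initial_no_count _ _)) // /sends tally0.
  by case: n.
rewrite /deacts tallyS => dx n; rewrite /sends tallyS.
have {}xchi : owner x \notin externals (conf t).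
  by apply: contra xchi; apply: externals_mono.
apply: (sent_count_step (exec_step tS)) => //; first by case: deactivates dx;
  lia.
by apply: IH => //; rewrite /deacts; lia.
Qed.

Lemma recv_counts t x : is_time len t -> rels x t = 0 ->
  forall n, knows (actors (conf t)) (target x) (RecvCount x n) =
            (n == recvs x t) && (0 < n).
Proof.
elim/time_ind: t / => [|t tS tt IH].
  move=> _ n; rewrite (negPf (initial_no_count _ _)) // /recvs tally0.
  by case: n.
rewrite {1}/rels tallyS -/(rels x t) => rx n; rewrite /recvs tallyS.
apply: (recv_count_step (exec_step tS) (addressed tt)).
  by apply/negP => /(released_known tt); lia.
by apply: IH; lia.
Qed.

(** [CreatedUsing y x] arises while [y] is activated, and SendRelease refuses to deactivate [y] as
    long as it is held. *)
Lemma created_using_activated t x y : is_time len t ->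
  knows (actors (conf t)) (owner y) (CreatedUsing y x) ->
  knows (actors (conf t)) (owner y) (Activated y).
Proof.
elim/time_ind: t / => [|t tS tt IH].
  case/initial_knows => [k [l [E [+ _ _]]]].
  by rewrite !(in_fset1U, in_fset1, in_fsetU) !eq_factE.
have st := exec_step tS; case/(knows_new st) => [yx|[xt yP]].
  by case: (knows_kept st (IH yx)) => // -[_ /(_ x)]; rewrite yx.
case: (knows_kept st yP) => // -[+ _].
(* The event creates [x], so it is not the SendRelease that would deactivate [y]. *)
by case: (evt t) xt.
Qed.

(** The refob [y] exists before the event that creates [x]; this decrease of time drives the
    induction of [Chain_unreleased]. *)
Definition parent t y x :=
  exists2 s, s < t /\ x \in created_by (evt s) & 0 < births y s.

Lemma parentW s t y x : s <= t -> parent s y x -> parent t y x.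
Proof. by move=> le_st [r [lt_rs xr] yr]; exists r;
  rewrite // (leq_trans lt_rs). Qed.

(** Both claims go in one induction, since an [Info] message arises from a [CreatedUsing] fact. *)
Lemma parentP t x y : is_time len t ->
  (knows (actors (conf t)) (owner y) (CreatedUsing y x) -> parent t y x) /\
  (forall B A, Info y x A \in inbox (undelivered (conf t)) B -> parent t y x).
Proof.
elim/time_ind: t / => [|t tS tt [IHk IHm]].
  split=> [|B A]; last by rewrite initial_inbox in_mset0.
  case/initial_knows => [k [l [E [+ _ _]]]].
  by rewrite !(in_fset1U, in_fset1, in_fsetU) !eq_factE.
have st := exec_step tS; split=> [|B A].
  case/(knows_new st) =>
    [/IHk/(parentW (leqnSn t))//|[xt /(activated_born tt) yP]].
  by exists t.
by case/(inbox_step st) => [/IHm|[_ _ _ /IHk]]; apply: parentW.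
Qed.

Lemma parent_born t y x : parent t y x -> 0 < births y t.
Proof. by case=> s [/ltnW/(leq_births y)]; lia. Qed.

Lemma sender t x : is_time len t.+1 -> sends_along x (evt t) ->
  owner x \in externals (conf t) \/
  exists2 Phi, (actors (conf t)).[? owner x] = Some (Busy Phi) &
    knows (actors (conf t)) (owner x) (Activated x).
Proof.
move=> tS; have tt := timeW (leqnSn t) tS.
case/(sends_along_step (exec_step tS)) => [|[Phi [EP P]]]; [by left|right].
exists Phi => //; case: P => [xP|[y yP]]; first by rewrite (knows_at _ EP).
by apply: (@created_using_activated t y) => //; rewrite (knows_at _ EP).
Qed.

Lemma deacts_internal t x : is_time len t -> 0 < deacts x t ->
  owner x \in domf (actors (conf t)).
Proof.
move=> tt /tally_gt0[s lt_st xs].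
have /exec_step st := timeW lt_st tt.
exact: (domf_mono (ltnW lt_st) tt (knows_domf (deactivates_step st xs))).
Qed.

(** A deactivated refob has an internal owner that no longer holds [Activated x], which every send
    by an internal owner requires. *)
Lemma sends_frozen t x : is_time len t.+1 -> 0 < deacts x t ->
  sends x t.+1 = sends x t.
Proof.
move=> tS dx; have tt := timeW (leqnSn t) tS; rewrite /sends tallyS.
case sx: (sends_along x (evt t)) => //; last by rewrite addn0.
case: (sender tS sx) => [|[Phi _ /(activated_deacts tt)]]; last by lia.
by rewrite (negPf (internal_not_external tt (deacts_internal tt dx))).
Qed.

Lemma flow t x : is_time len t ->
  recvs x t + pending (along x) (undelivered (conf t)) (target x) <= sends x t.
Proof.
elim/time_ind: t / => [|t tS tt IH];
  first by rewrite initial_pending /recvs tally0.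
have := flow_step x (exec_step tS) (addressed tt).
rewrite /recvs /sends !tallyS -/(recvs x t) -/(sends x t); lia.
Qed.

Lemma release_flow t x : is_time len t ->
  pending (releases x) (undelivered (conf t)) (target x) + rels x t <= deacts
    x t.
Proof.
elim/time_ind: t / => [|t tS tt IH];
  first by rewrite initial_pending /rels tally0.
have := release_flow_step x (exec_step tS).
rewrite /rels /deacts !tallyS -/(rels x t) -/(deacts x t); lia.
Qed.

Lemma release_pending t x n B : is_time len t ->
    Release x n \in inbox (undelivered (conf t)) B ->
  [/\ target x = B, 0 < deacts x t, rels x t = 0 & n = sends x t].
Proof.
move=> tt xn; have xB : target x = B := addressed tt xn.
have : 0 < pending (releases x) (undelivered (conf t)) (target x).
  by apply/pendingP; exists (Release x n); rewrite ?xB /=.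
have := release_flow x tt; have := budget x tt; have := births_le1 x tt.
(* Pending and consumed releases together are at most [deacts x t], hence at most one, and one is
   pending. *)
move=> b1 bd rd pd; split=> //; try lia.
(* The number in the message is the send count stored when it was posted, and nothing has been sent
   along [x] since. *)
move: xn {b1 bd rd pd}; elim/time_ind: t / tt => [|t tS tt IH].
  by rewrite initial_inbox in_mset0.
case/(inbox_step (exec_step tS)) => [xn|[_ xt]].
  rewrite sends_frozen ?(IH xn) //.
  have : 0 < pending (releases x) (undelivered (conf t)) (target x).
    by apply/pendingP; exists (Release x n); rewrite ?xB /=.
  by have := release_flow x tt; lia.
have xP := deactivates_step (exec_step tS) xt.
rewrite sent_counts ?(activated_deacts tt) ?(internal_not_external tt
  (knows_domf xP)) //.
case/andP=> /eqP-> _; rewrite /sends tallyS.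
by case: (evt t) xt => //= *; rewrite addn0.
Qed.

(* Release is only consumed when the counts at both ends agree. *)
Lemma released_drained t x : is_time len t -> 0 < rels x t ->
  sends x t <= recvs x t.
Proof.
elim/time_ind: t / => [|t tS tt IH]; first by rewrite /rels tally0.
have leR : recvs x t <= recvs x t.+1 by apply: leq_tally.
rewrite {1}/rels tallyS -/(rels x t); case: (posnP (rels x t)) => [r0|r_gt0 _].
  rewrite r0 lt0b => xt;
    have [n [Phi [EB xn dn]]] := frees_step (exec_step tS) xt.
  have [_ dx _ n_sends] := release_pending tt xn.
  have := derives_recv_count _ dn; move/(_ (recvs x t)) => nE.
  rewrite sends_frozen // -n_sends nE // => i.
  by rewrite -(recv_counts tt r0) (knows_at _ EB).
rewrite sends_frozen //; first by have := IH r_gt0; lia.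
by have := release_flow x tt; lia.
Qed.

Lemma activated_unreleased t x : is_time len t ->
  knows (actors (conf t)) (owner x) (Activated x) -> rels x t = 0.
Proof. by move=> tt /(activated_deacts tt); have := release_flow x tt; lia. Qed.

Lemma external_unreleased t x : is_time len t ->
  owner x \in externals (conf t) -> rels x t = 0.
Proof.
move=> tt xchi; apply/eqP; rewrite -leqn0 leqNgt; apply/negP => rx.
have /(deacts_internal tt)/(internal_not_external tt) : 0 < deacts x t.
  by have := release_flow x tt; lia.
by rewrite xchi.
Qed.

(** After a release, [released_drained] and [flow] leave no room for a pending message. *)
Lemma pending_unreleased t x : is_time len t ->
  0 < pending (along x) (undelivered (conf t)) (target x) -> rels x t = 0.
Proof.
move=> tt px; case: (posnP (rels x t)) => // /(released_drained tt).
by have := flow x tt; lia.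
Qed.

(** A message from outside may use a refob that no event created; its receiver is then a
    receptionist, and remains one. *)
Lemma app_pending t x R B : is_time len t ->
    App x R \in inbox (undelivered (conf t)) B ->
  B \in receptionists (conf t) \/ 0 < births x t.
Proof.
elim/time_ind: t / => [|t tS tt IH]; first by rewrite initial_inbox in_mset0.
have recS : B \in receptionists (conf t) -> B \in receptionists (conf t.+1).
  by case: (exec_step tS) => //= *; rewrite in_fsetU; apply/orP; left.
case/(inbox_step (exec_step tS)) => [/IH[/recS|xP]|[_ _ [xP|/recS]]];
  try by left.
  by right; rewrite birthsS; lia.
by right; have := activated_born tt xP; rewrite birthsS; lia.
Qed.

(** An actor becomes a receptionist when an Out event hands a refob to it to an external actor. By
    [budget], the carried refob was created, and its owner stays external. *)
Lemma receptionist_reachable t B : is_time len t ->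
    B \in receptionists (conf t) ->
  exists z, [/\ target z = B, owner z \in externals (conf t) & 0 < births z t].
Proof.
elim/time_ind: t / => [|t tS tt IH]; first by rewrite initial_receptionists.
have st := exec_step tS.
case/(receptionists_step st) => [/IH[z [zB zchi zb]]|].
  by exists z; rewrite zB birthsS (externals_step st zchi) ltn_addr.
case=> E [y [R [z [[Echi yR zR zB] _]]]]; exists z.
have [_ /(_ z zR) zE] := addressed tt yR.
rewrite zB zE (externals_step st Echi); split=> //.
apply: leq_trans (leq_births _ (leqnSn t)).
have : 0 < pending (carries z) (undelivered (conf t)) (owner z).
  by rewrite zE; apply/pendingP; exists (App y R).
by have := budget z tt; lia.
Qed.

(* The last case is a refob imported from outside by an In event. *)
Lemma chain_link t x : is_time len t ->
    0 < births x t -> rels x t = 0 -> target x \in domf (actors (conf t)) ->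
  [\/ knows (actors (conf t)) (target x) (Created x),
      exists y, target y = target x /\
        knows (actors (conf t)) (owner y) (CreatedUsing y x),
      exists y, Info y x (owner x) \in inbox (undelivered (conf t)) (target x)
    | exists s, [/\ s < t, x \in created_by (evt s)
                  & target x \in receptionists (conf s)]].
Proof.
elim/time_ind: t / => [|t tS tt IH].
  rewrite {1}/births tally0 addn0 lt0b =>
    /initial_knows[k [l [E [fP Echi kl]]]] _ xD.
  move: fP; rewrite !(in_fset1U, in_fset1, in_fsetU) !eq_factE orbF =>
    /orP[]/eqP Ex.
    by move/initial_disjoint: xD; rewrite Ex /= Echi.
  by apply: Or41; rewrite -Ex in kl; rewrite (_ : target x = owner x) // Ex.
have st := exec_step tS.
rewrite birthsS {1}/rels tallyS -/(rels x t) => bx rx xD.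
case: (boolP (x \in created_by (evt t))) bx => [xt _|_].
  case: (born_step st xt) => [[_]|[y [Ey _ yx]]|[xrho|xchi]].
  - exact: Or41.
  - by apply: Or42; exists y.
  - by apply: Or44; exists t.
  by rewrite (negPf (internal_not_external tS xD)) in xchi.
rewrite addn0 => bx; have {}rx : rels x t = 0 by lia.
have xD' : target x \in domf (actors (conf t)).
  have [_ /orP[//|xchi]] := (existing_refobs tt).2 _ bx.
  by have := internal_not_external tS xD; rewrite (externals_step st xchi).
have {IH}[xP|[y [Ey yx]]|[y yx]|[s [lt_st xs xrho]]] := IH bx rx xD'.
(* Forgetting [Created x] presupposes [Released x], against [rx]. *)
- case: (knows_kept st xP) => [|/(released_known tt)]; [exact: Or41|lia].
- case: (knows_kept st yx) => [yx'|[_ m]]; first by apply: Or42; exists y.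
  by apply: Or43; exists y.
- case: (info_kept st yx) => [m||xchi].
  + by apply: Or43; exists y.
  + exact: Or41.
  by have := internal_not_external tS xD; rewrite (externals_step st xchi).
by apply: Or44; exists s; rewrite ltnW.
Qed.


(** * Finalized snapshot sets *)

Context (Q : {fmap Actor -> knowledge Token Actor}) (when : Actor -> nat).
Context (snap : snapshot_set len evt Q when) (final : finalized Q).

Lemma Chain_created x :
  Qderives Q (Created x) -> ~ Qderives Q (Released x) -> Chain Q x.
Proof. by move=> Cx Rx; exists x, [::]; split=> // y;
  rewrite inE => /eqP->. Qed.

Lemma Chain_created_using y x : Chain Q y -> target y = target x ->
  Qderives Q (CreatedUsing y x) -> ~ Qderives Q (Released x) -> Chain Q x.
Proof.
case=> x1 [s [ls tg C1 R1 lk]] Eyx yx Rx; exists x1, (rcons s x).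
split=> // [|z|i]; first by rewrite last_rcons.
  by rewrite -rcons_cons mem_rcons inE => /predU1P[->//|/tg->].
rewrite size_rcons ltnS -rcons_cons !nth_rcons /= ltnS => le_is.
rewrite le_is; move: le_is; rewrite leq_eqVlt => /predU1P[->|lt_is].
  (* At [i = size s] the link starts from the last element of [x1 :: s], which is [y]. *)
  by rewrite ltnn eqxx -[size s]/((size (x1 :: s)).-1) nth_last /= ls.
by rewrite lt_is; apply: lk.
Qed.

Lemma snapshot_state A Phi : Q.[? A] = Some Phi ->
  [/\ is_time len (when A).+1, is_time len (when A),
    evt (when A) = ESnapshot A Phi,
      (actors (conf (when A))).[? A] = Some (Idle Phi)
    & conf (when A).+1 = conf (when A)].
Proof.
move=> /snap[tS Ee]; have := exec_step tS; rewrite Ee => /snapshot_step[EA Ec].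
by split=> //; apply: timeW tS.
Qed.

Lemma snapshot_some A : A \in domf Q -> exists Phi, Q.[? A] = Some Phi.
Proof. by case: fndP => // AQ _; exists Q.[AQ]. Qed.

Lemma snapshot_domf A : A \in domf Q ->
  is_time len (when A) /\ A \in domf (actors (conf (when A))).
Proof.
case/snapshot_some=> Phi /snapshot_state[_ tw _ EA _].
by split=> //; apply: some_domf EA.
Qed.

Lemma not_Qreleased x : rels x (when (target x)) = 0 ->
  ~ Qderives Q (Released x).
Proof.
move=> r0 [Phi /= /snapshot_state[_ tw _ EA _] /derives_released xP].
have := @released_known (when (target x)) (target x) x tw.
by rewrite (knows_at _ EA) r0 => /(_ xP).
Qed.

(** Relevance puts the same number in both snapshots. It is the true send count because the owner
    still holds [Activated y], and the true receive count because [y] is not yet released. *)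
Lemma Chain_counts y : Chain Q y -> target y \in domf Q ->
    rels y (when (target y)) = 0 ->
  exists Phi, [/\ Q.[? owner y] = Some Phi, Activated y \in Phi
    & sends y (when (owner y)) = recvs y (when (target y))].
Proof.
move=> ch BQ r0; have [_ [n [[Phi /= EA /derives_activated yP] [Phi' /= EA'
  sn] [Psi /= EB rn]]]] :=
  final BQ erefl ch.
move: EA'; rewrite EA => -[EP]; subst Phi'; exists Phi; split=> //.
have [_ tA _ KA _] := snapshot_state EA;
  have [_ tB _ KB _] := snapshot_state EB.
transitivity n; last first.
  by apply: (derives_recv_count _ rn) => i;
    rewrite -(recv_counts tB r0) (knows_at _ KB).
apply/esym/(derives_sent_count _ sn) => i.
rewrite -sent_counts ?(knows_at _ KA) //;
  first by apply/internal_not_external/(some_domf KA).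
by apply: activated_deacts; rewrite // (knows_at _ KA).
Qed.

(** The claim proved by induction on time. It covers all [r <= T], because freezing is traced back
    to the snapshot; the strict [when A < r] matches [before]. *)
Definition blocked_until T :=
  forall r A, r <= T -> A \in domf Q -> when A < r -> blocked (conf r) A.

(** * The induction step from [T] to [T.+1] *)

Section Blocked.
Context (T : nat) (tT : is_time len T.+1) (bl : blocked_until T).

(** The bound is [T.+1] because being blocked at time [T] controls the event leading to [T.+1]. *)
Lemma snapshot_frozen A Phi r : Q.[? A] = Some Phi -> when A <= r <= T.+1 ->
  exists Phi', [/\ (actors (conf r)).[? A] = Some (Idle Phi'),
    {subset Phi' <= Phi}, forall x, Activated x \in Phi -> Activated x \in Phi'
    & forall x, owner x = A -> sends x r = sends x (when A)].
Proof.
move=> EQ; have [_ _ Ee EA Ec] := snapshot_state EQ.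
elim: r => [|r IH].
  by rewrite leqn0 => /andP[/eqP w0 _]; move: EA; rewrite w0; exists Phi; split.
case/andP; rewrite leq_eqVlt => /predU1P[<-|]; first by exists Phi; split.
rewrite ltnS => le_wr lt_rT.
have [|Phi1 [E1 sub1 act1 snd1]] := IH; first by rewrite le_wr ltnW.
have tr1 : is_time len r.+1 by apply: timeW tT.
move: le_wr; rewrite leq_eqVlt => /predU1P[Er|lt_wr].
  (* [bl] says nothing at time [when A], but the event there is the snapshot itself, which changes
     nothing. *)
  exists Phi; split=> //; rewrite -?Er ?Ec // => x _.
  by rewrite /sends tallyS Ee addn0.
have AQ : A \in domf Q by case: fndP EQ.
have [[Phi2 E2] nrho in0] := bl lt_rT AQ lt_wr.
have [Phi' E' [sub' act']] := blocked_step (exec_step tr1) E1 nrho in0.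
exists Phi'; split=> // [f /sub'/sub1//|x /act1/act'//|x xA].
rewrite /sends tallyS -/(sends x r) snd1 //.
case sx: (sends_along x (evt r)); last by rewrite addn0.
have [|[Psi]] := sender tr1 sx; last by rewrite xA E1.
by rewrite xA (negPf (internal_not_external (timeW (leqnSn r) tr1) (some_domf
  E1))).
Qed.

(** Past its snapshot the owner is frozen; before it, the send count can only grow towards the
    recorded value. *)
Lemma frozen_sends y t : Chain Q y -> target y \in domf Q ->
    rels y (when (target y)) = 0 -> t <= T.+1 -> is_time len t ->
  sends y t <= recvs y (when (target y)).
Proof.
move=> ch BQ r0 le_tT tt; have [Phi [EA _ <-]] := Chain_counts ch BQ r0.
case: (leqP (when (owner y)) t) => [le_wt|/ltnW]; last exact: leq_tally.
have [|Phi' [_ _ _ ->//]] := @snapshot_frozen _ _ t EA.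
by rewrite le_wt.
Qed.

(** By [frozen_sends], everything sent by time [t] was already received at the snapshot of the
    target. *)
Lemma nothing_pending y t : Chain Q y -> target y \in domf Q ->
    rels y (when (target y)) = 0 -> when (target y) <= t <= T.+1 ->
  pending (along y) (undelivered (conf t)) (target y) = 0.
Proof.
move=> ch BQ r0 /andP[le_wt le_tT]; have tt := timeW le_tT tT.
have := frozen_sends ch BQ r0 le_tT tt; have := flow y tt.
have := leq_tally (receives_along y) le_wt; rewrite /recvs; lia.
Qed.

(** Only SendInfo removes the fact, and it sends a message along [y]. *)
Lemma created_using_persists y x s t : s <= t -> is_time len t ->
  knows (actors (conf s)) (owner y) (CreatedUsing y x) ->
  knows (actors (conf t)) (owner y) (CreatedUsing y x) \/ sends y s < sends y t.
Proof.
move=> + tt yx; elim/time_ind: t / tt => [|t tS tt IH].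
  by rewrite leqn0 => /eqP <-; left.
rewrite leq_eqVlt => /predU1P[<-|lt_st]; first by left.
rewrite /sends tallyS; case: (IH lt_st) => [yx'|]; last by right;
  rewrite ltn_addr.
case: (knows_kept (exec_step tS) yx') => [|[-> _]]; first by left.
by right; rewrite addn1 ltnS leq_tally.
Qed.

Lemma created_using_snapshot y x s : Chain Q y -> target y \in domf Q ->
    rels y (when (target y)) = 0 -> when (target y) <= s <= T.+1 ->
    knows (actors (conf s)) (owner y) (CreatedUsing y x) ->
  Qderives Q (CreatedUsing y x).
Proof.
move=> ch BQ r0 /andP[le_ws le_sT] yx; have ts := timeW le_sT tT.
have [Phi [EA _ Es]] := Chain_counts ch BQ r0; exists Phi => //.
apply: derives_mem; case: (leqP (when (owner y)) s) => [le_as|/ltnW le_sa].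
  have [|Phi' [E' sub _ _]] := @snapshot_frozen _ _ s EA;
    first by rewrite le_as.
  by apply: sub; move: yx; rewrite (knows_at _ E').
have [_ ta _ KA _] := snapshot_state EA.
(* A send along [y] after [s] would raise the send count above the receive count of the target's
   snapshot, to which it is equal at the owner's snapshot. *)
case: (created_using_persists le_sa ta yx); first by rewrite (knows_at _ KA).
have := leq_tally (receives_along y) le_ws; have := flow y ts.
by rewrite Es /recvs; lia.
Qed.

(** Chains are assumed here so that the lemma serves both inside the induction of [Chain_unreleased]
    and after it. *)
Lemma no_receptionist B r : B \in domf Q -> is_time len r ->
    (forall z, 0 < births z r -> target z = B -> rels z (when B) = 0 ->
      Chain Q z) ->
  B \notin receptionists (conf r).
Proof.
move=> BQ tr ch; apply/negP => /(receptionist_reachable tr)[z [zB zchi zb]].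
(* Otherwise [owner z] would be both internal and external at the later of [r] and [s]. *)
have extern s : is_time len s -> owner z \in domf (actors (conf s)) -> False.
  move=> ts zD; case: (leqP s r) => [le_sr|/ltnW le_rs].
    by have := internal_not_external tr (domf_mono le_sr tr zD); rewrite zchi.
  by have := internal_not_external ts zD;
    rewrite (externals_mono le_rs ts zchi).
have [tB _] := snapshot_domf BQ.
have r0 : rels z (when B) = 0.
  case: (leqP r (when B)) => [le_rB|/ltnW le_Br].
    exact/(external_unreleased tB)/(externals_mono le_rB).
  have := leq_tally (frees z) le_Br;
    rewrite -/(rels z r) external_unreleased //.
  by rewrite leqn0 => /eqP.
have [|/snapshot_domf[tz]] := final _ zB (ch z zb zB r0);
  first by rewrite // zB.
by move/(extern _ tz).
Qed.

(** Strong induction on [s]: a refob used to create [x] already exists at the creation of [x], hence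
    at a time below [s]. Release is excluded at [when B], as [not_Qreleased] and [Chain_counts]
    require. *)
Lemma Chain_unreleased B s x : B \in domf Q -> when B <= T -> s <= T.+1 ->
  0 < births x s -> target x = B -> rels x (when B) = 0 -> Chain Q x.
Proof.
move=> BQ le_wT; elim/ltn_ind: s x => s IH x le_sT xs xB rx; subst B.
have [tw BD] := snapshot_domf BQ; have nR := not_Qreleased rx.
have IHs r z : r < s -> 0 < births z r -> target z = target x ->
    rels z (when (target x)) = 0 -> Chain Q z.
  by move=> lt_rs; apply: (IH r) => //; apply: leq_trans (ltnW lt_rs) le_sT.
have norec r : r < s -> target x \notin receptionists (conf r).
  move=> lt_rs; apply: no_receptionist => //.
    by apply: timeW tT; apply: leq_trans (ltnW lt_rs) le_sT.
  by move=> z; apply: IHs.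
have extend y r : Chain Q y -> target y = target x ->
    rels y (when (target x)) = 0 -> when (target x) <= r <= T.+1 ->
    knows (actors (conf r)) (owner y) (CreatedUsing y x) -> Chain Q x.
  move=> chy Eyx ry wr yx; apply: (Chain_created_using chy Eyx) => //.
  by apply: (created_using_snapshot chy _ _ _ yx); rewrite Eyx.
case: (posnP (births x (when (target x)))) => [xw|xw]; last first.
  (* As [x] is created only once, its creation precedes [s] even if [s] lies before the snapshot of
     its target. *)
  have bornS r : r < when (target x) -> x \in created_by (evt r) -> r < s.
    by move=> lt_rw xr; apply: births_inj xr xs; apply: timeW tw.
  case: (chain_link tw xw rx BD) =>
    [Cx|[y [Eyx yx]]|[y yx]|[r [lt_rw xr xrho]]].
  - apply: Chain_created => //; have [Phi EB] := snapshot_some BQ.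
    exists Phi => //; apply: derives_mem.
    by have [_ _ _ EB' _] := snapshot_state EB; rewrite (knows_at _ EB') in Cx.
  - have [r [lt_rw xr] yr] := (parentP x y tw).1 yx.
    have ry := activated_unreleased tw (created_using_activated tw yx).
    apply: (extend y (when (target x))) => //; last by rewrite leqnn leqW.
    by apply: (IHs r) => //; apply: bornS lt_rw xr.
  (* A pending [Info] along [y] shows that [y] is unreleased; so [y] has a chain, and
     [nothing_pending] refutes the message. *)
  - have Eyx : target y = target x := addressed tw yx.
    have [r [lt_rw xr] yr] := (parentP x y tw).2 _ _ yx.
    have py : 0 < pending (along y) (undelivered (conf (when (target y))))
      (target y).
      by apply/pendingP; exists (Info y x (owner x)); rewrite ?Eyx /=.
    have ry : rels y (when (target y)) = 0.
      by apply: pending_unreleased; rewrite // Eyx.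
    have chy : Chain Q y.
      by apply: (IHs r) => //; rewrite -?Eyx //; apply: bornS lt_rw xr.
    have w_ok : when (target y) <= when (target y) <= T.+1 by rewrite leqnn
      Eyx leqW.
    by rewrite (nothing_pending chy _ ry w_ok) ?Eyx in py.
  - by rewrite (negPf (norec r (bornS r lt_rw xr))) in xrho.
(* The creation event lies between the snapshot of the target and [s]. *)
have [r lt_rs xr] : exists2 r, r < s & x \in created_by (evt r).
  apply: (@tally_gt0 (fun e => x \in created_by e)); move: xs xw;
    rewrite /births; lia.
have le_wr : when (target x) <= r.
  rewrite leqNgt; apply/negP => lt_rw; move: xw; rewrite /births.
  have := @tally_has (fun e => x \in created_by e) _ _ lt_rw xr; lia.
have le_rT : r < T.+1 by apply: leq_trans le_sT.
have trS := timeW le_rT tT; have tr := timeW (leqnSn r) trS.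
have xD := domf_mono le_wr tr BD; have st := exec_step trS.
(* Spawn is impossible since the target already exists, In since the target is neither a
   receptionist nor external. *)
case: (born_step st xr) => [[]|[y [Eyx yP yx]]|[]]; first by rewrite xD.
- have ry : rels y (when (target x)) = 0.
    apply/eqP; rewrite -leqn0 -(activated_unreleased tr yP).
    exact: leq_tally le_wr.
  apply: (extend y r.+1) => //; last by rewrite (leqW le_wr).
  exact: IHs lt_rs (activated_born tr yP) Eyx ry.
- by rewrite (negPf (norec r lt_rs)).
by rewrite (negPf (internal_not_external trS (domf_step st xD))).
Qed.

Lemma blocked_untilS : blocked_until T.+1.
Proof.
move=> r B; rewrite leq_eqVlt => /predU1P[->{r}|]; last exact: bl.
move=> BQ; rewrite ltnS => le_wT;
  have wT : when B <= T.+1 <= T.+1 by rewrite leqnn leqW.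
have ch x : 0 < births x T.+1 -> target x = B -> rels x (when B) = 0 ->
  Chain Q x.
  exact: Chain_unreleased.
have relsW x : rels x T.+1 = 0 -> rels x (when B) = 0.
  by have /andP[/(leq_tally (frees x)) + _] := wT; rewrite /rels; lia.
have norec : B \notin receptionists (conf T.+1) by apply: no_receptionist.
split=> //.
  have [Phi EB] := snapshot_some BQ.
  by have [Phi' [E' _ _ _]] := snapshot_frozen EB wT; exists Phi'.
(* A message pending along [y] keeps [y] unreleased, so [y] has a chain and [nothing_pending]
   applies. *)
have noalong m y : m \in inbox (undelivered (conf T.+1)) B -> along y m ->
    target y = B -> 0 < births y T.+1 -> False.
  move=> mB ym yB yb; subst B.
  have py : 0 < pending (along y) (undelivered (conf T.+1)) (target y).
    by apply/pendingP; exists m.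
  have ry := relsW _ (pending_unreleased tT py).
  by rewrite (nothing_pending (ch _ yb erefl ry)) in py.
apply/msetP => m; rewrite mset0E; apply/mset_eq0P/negP => mB.
case: m mB => [y R|y x A|x n] mB.
- have [yB _] := addressed tT mB; have [|yb] := app_pending tT mB.
    by rewrite (negPf norec).
  by apply: noalong mB _ yB yb => /=.
- apply: (noalong _ y mB _ (addressed tT mB)) => //=.
  exact: parent_born ((parentP x y tT).2 _ _ mB).
have [xB dx rx _] := release_pending tT mB.
have xb : 0 < births x T.+1 by have := budget x tT; lia.
subst B; have [Phi [EA xP _]] := Chain_counts (ch _ xb erefl (relsW _ rx)) BQ
  (relsW _ rx).
(* The snapshot of the owner holds [Activated x], yet [x] is deactivated by [T.+1]. Either the owner
   was frozen with this fact, or its snapshot came after the deactivation; both contradict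
   [activated_deacts]. *)
case: (leqP (when (owner x)) T.+1) => [le_aT|lt_Ta].
  have [|Phi' [E' _ act _]] := @snapshot_frozen _ _ T.+1 EA;
    first by rewrite le_aT leqnn.
  have := @activated_deacts T.+1 x tT;
    rewrite (knows_at _ E') => /(_ (act _ xP)); lia.
have [_ ta _ KA _] := snapshot_state EA.
have := @activated_deacts _ x ta; rewrite (knows_at _ KA) => /(_ xP).
by have := leq_tally (deactivates x) (ltnW lt_Ta); move: dx; rewrite /deacts;
  lia.
Qed.
End Blocked.

Lemma all_blocked T : is_time len T -> blocked_until T.
Proof.
elim/time_ind: T / => [|T tS _ bl]; last exact: blocked_untilS.
by move=> r A; rewrite leqn0 => /eqP->.
Qed.

End Execution.

Theorem theorem6p8 (Token Actor : choiceType) (len : option nat)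
    (conf : nat -> config Token Actor) (evt : nat -> event Token Actor)
    (Q : {fmap Actor -> knowledge Token Actor}) (when : Actor -> nat)
    (tf : nat) :
  execution len conf evt ->
  snapshot_set len evt Q when ->
  finalized Q ->
  (forall A, A \in domf Q -> when A < tf) ->
  forall t, is_time len t ->
    [/\ forall B x, B \in domf (before Q when t) -> target x = B ->
          unreleased_at conf evt t x -> Chain Q x,
        forall B, B \in domf (before Q when t) -> blocked (conf t) B
      & tf <= t -> before Q when t = Q].
Proof.
move=> exec snap final early t tt.
have dom B : B \in domf (before Q when t) -> B \in domf Q /\ when B < t.
  by rewrite mem_restrictf => /andP[+ BQ]; rewrite in_fset /= inE => /andP[].
split=> [B x /dom[BQ lt_wt] xB [xb xr]|B /dom[BQ lt_wt]|le_ft].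
(* No snapshot precedes time 0; at [t.+1] the induction is used up to [t]. *)
- case: t => // t in tt {dom} lt_wt xb xr *.
  have bl := all_blocked exec snap final (timeW (leqnSn t) tt).
  apply: (Chain_unreleased exec snap final tt bl BQ lt_wt (leqnn _) _ xB).
    exact/(created_beforeP exec).
  apply/eqP; rewrite -leqn0 leqNgt; apply/negP => rx; apply: xr.
  by apply/released_beforeP; apply: leq_trans rx (leq_tally _ _ (ltnW lt_wt)).
- exact: (all_blocked exec snap final tt).
apply/fmapP => A; rewrite fnd_restrict; case: ifP => // nA.
case: fndP => // AQ; move: nA; rewrite in_fset /= inE AQ.
by rewrite (leq_trans (early _ AQ)).
Qed.
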